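(* There exist constants $\alpha_r$ (for integers $r\ge 2$) with $\alpha_r \in O(r^5\log^2 r)$ such that the following holds for every integer $r\geq 2$: if $G$ is a simple $n$-vertex edge-colored graph with exactly $n$ color classes, each of size at least $2$ and at most $r$, then $G$ contains a rainbow cycle of length at most $$\frac{n+\operatorname{def}_r(G)}{r}+\alpha_r.$$
   Context: An edge-colored graph is a (multi)graph whose edges are each assigned a color; a color class is the set of edges of a given color. The edge-colored graph $G$ is simple if no color class contains parallel edges (edges of different colors may be parallel). A subgraph is rainbow if no two of its edges have the same color. $C(G)$ denotes the set of colors appearing in $E(G)$, and for $c\in C(G)$, $c_G$ is the set of edges of $G$ of color $c$. For $r\in\mathbb{N}$, $\operatorname{def}_r(G):=\sum_{c\in C(G),\,|c_G|\le r}(r-|c_G|)$. Logarithms are base 2. *)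

(* Defs.v *)
From HB Require Import structures.
From mathcomp Require Import all_boot all_order all_algebra.
From mathcomp Require Import all_classical all_reals all_analysis.

Set Implicit Arguments.
Unset Strict Implicit.
Unset Printing Implicit Defensive.

Import Order.TTheory GRing.Theory Num.Theory.

Local Open Scope nat_scope.

(* A finite edge-colored multigraph. Edges are abstract, so several edges may
   have the same set of ends; an edge with a single end is a loop. The palette
   may contain colors that are not used by any edge. *)
Record ecgraph := ECGraph {
  vertex : finType;
  edge : finType;
  palette : finType;
  ends : edge -> {set vertex};
  color : edge -> palette;
  card_ends : forall e, 0 < #|ends e| <= 2
}.

Section EdgeColoredGraph.
Variable G : ecgraph.

Definition colors : {set palette G} := [set color e | e : edge G].

Definition color_class (c : palette G) : {set edge G} :=
  [set e | color e == c].

Definition parallel (e f : edge G) : Prop := e <> f /\ ends e = ends f.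

Definition simple_ecgraph : Prop :=
  forall (c : palette G) (e f : edge G),
    e \in color_class c -> f \in color_class c -> ~ parallel e f.

Definition rainbow (S : {set edge G}) : Prop := {in S &, injective (@color G)}.

(* [ordS] is the cyclic successor i |-> i + 1 mod k. A cycle of length 1 is a
   loop and a cycle of length 2 is a pair of parallel edges. *)
Definition is_cycle (k : nat) (v : 'I_k -> vertex G) (e : 'I_k -> edge G)
    : Prop :=
  [/\ 0 < k, injective v, injective e
    & forall i : 'I_k, ends (e i) = [set v i; v (ordS i)]].

Definition has_rainbow_cycle (k : nat) : Prop :=
  exists (v : 'I_k -> vertex G) (e : 'I_k -> edge G),
    is_cycle v e /\ rainbow [set e i | i : 'I_k].

Definition deficiency (r : nat) : nat :=
  \sum_(c in colors | #|color_class c| <= r) (r - #|color_class c|).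

End EdgeColoredGraph.

Definition log2 (R : realType) (x : R) : R := (ln x / ln 2)%R.

(* Main.v *)
Require Import Defs.
From mathcomp Require Import all_boot.
From mathcomp Require Import zify ring.
From mathcomp Require Import boolp.

Set Implicit Arguments.
Unset Strict Implicit.
Unset Printing Implicit Defensive.

Local Open Scope nat_scope.

(** Give a color class of size [s] the weight [r + 1 - s], so that the total
    weight is [n + def_r(G)]. If every vertex [v] has a class all of whose edges
    contain [v], orient these edges away from [v]: directed cycles are then
    rainbow cycles, and a digraph with [n] vertices and out-degrees at least [r]
    has a closed walk of length at most [n / r + O(r^2)]; a missing out-neighbor
    is paid for by adding a copy of an existing one.
    If some vertex [z] has no such class, deleting [z] empties no class and
    increases the excess of colors over vertices. The excess cannot exceed
    [O(r log r)], because choosing one edge per color then leaves a graph of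
    edge density [1 + Omega(r log r / n)], in which balls grow so fast that a
    cycle closes within length about [n / r]. A deletion is affordable because few
    colors touch [z]: otherwise a short-distance cluster around [z], with one
    color fewer than vertices, collects more weight than its diameter costs, and
    contracting it gives a smaller counterexample. The classes reduced to one edge
    by the deletion are removed by contracting clusters as well. *)

(** * Short closed walks in digraphs of large out-degree *)

Section DirectedWalks.
Variable T : finType.
Implicit Types (N : T -> {set T}) (W X : {set T}) (u v w x : T).

Fixpoint dwalk N k u w : bool :=
  if k is k'.+1 then [exists x in N u, dwalk N k' x w] else u == w.

Definition dclosed N W k := (0 < k) && [exists u in W, dwalk N k u u].

Lemma dwalk_cat N i j u v w :
  dwalk N i u v -> dwalk N j v w -> dwalk N (i + j) u w.
Proof.
elim: i u => [|i IHi] u /=; first by move/eqP->.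
case/existsP => x /andP [xN xv] vw; apply/existsP; exists x.
by rewrite xN IHi.
Qed.

Lemma dwalk1 N u x : x \in N u -> dwalk N 1 u x.
Proof. by move=> xN /=; apply/existsP; exists x; rewrite xN eqxx. Qed.

Lemma dwalk_mono N N' W k u w :
  (forall v, v \in W -> N v \subset N' v :&: W) -> u \in W ->
  dwalk N k u w -> dwalk N' k u w.
Proof.
move=> NW; elim: k u => [|k IHk] u uW //=.
case/existsP => x /andP [xN xw]; apply/existsP; exists x.
have /setIP [xN' xW] := subsetP (NW _ uW) _ xN.
by rewrite xN' IHk.
Qed.

Lemma dclosed_mono N N' W W' k :
  W \subset W' -> (forall v, v \in W -> N v \subset N' v :&: W) ->
  dclosed N W k -> dclosed N' W' k.
Proof.
move=> sW NW /andP [k0 /existsP [u /andP [uW uu]]]; rewrite /dclosed k0 /=.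
by apply/existsP; exists u; rewrite (subsetP sW) //= (dwalk_mono NW uW uu).
Qed.

(* Any walk for [N'] either uses no new arc, or has a first and a last one. *)
Lemma dwalk_split N N' (Bad : pred T) (Z W : {set T}) k u w :
  (forall v, v \in W -> N' v \subset W) ->
  (forall v x, v \in W -> x \in N' v -> x \notin N v -> Bad v && (x \in Z)) ->
  u \in W -> dwalk N' k u w ->
  dwalk N k u w \/
  exists i j a b, [/\ i + j < k, Bad a && (a \in W), b \in Z,
    dwalk N i u a & dwalk N j b w].
Proof.
move=> NW new; elim: k u => [|k IHk] u uW /=; first by left.
case/existsP => x /andP [xN xw].
have xW := subsetP (NW _ uW) _ xN.
have [xNu | xNu] := boolP (x \in N u).
  have [h | [i [j [a [b [ij aB bZ ua bw]]]]]] := IHk _ xW xw.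
    by left; apply/existsP; exists x; rewrite xNu.
  right; exists i.+1, j, a, b; split=> //.
  by apply/existsP; exists x; rewrite xNu.
have /andP [uB xZ] := new _ _ uW xN xNu.
right; have [h | [i [j [a [b [ij aB bZ ua bw]]]]]] := IHk _ xW xw.
  by exists 0, k, u, x; split; rewrite //= ?uB ?uW.
exists 0, j, u, b; split; rewrite //= ?uB ?uW //.
by rewrite add0n ltnS (leq_trans (leq_addl i j)) // ltnW.
Qed.

End DirectedWalks.

Lemma card_ord_ltn n k : k <= n -> #|[set j : 'I_n | j < k]| = k.
Proof.
move=> kn; rewrite -sum1_card.
rewrite (eq_bigl (fun j : 'I_n => j < k)); last by move=> j; rewrite inE.
by rewrite (big_ord_narrow kn) sum1_card card_ord.
Qed.

(** * Padding out-degrees by duplicating vertices *)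

Section Twins.
Variables (T : finType) (r : nat) (W : {set T}) (N : T -> {set T}).
Hypothesis NW : forall v, v \in W -> N v \subset W.
Hypothesis N0 : forall v, v \in W -> N v != set0.

Let m v := r - #|N v|.
Let y v := odflt v [pick x in N v].
(** [(v, None)] is [v] itself, while [(v, Some j)] is the [j]-th copy of [y v] made for the sake of
    [v]; [hd] sends each twin to the vertex that it duplicates. *)
Let twin := (T * option 'I_r)%type.
Let fresh v : {set option 'I_r} := [set Some j | j in [set j : 'I_r | j < m v]].
Let hd (p : twin) := if p.2 is Some _ then y p.1 else p.1.
Let W' : {set twin} := [set p | (p.1 \in W) && (p.2 \in None |: fresh p.1)].
Let N' (p : twin) : {set twin} :=
  setX (N (hd p)) [set None] :|: setX [set hd p] (fresh (hd p)).

Let yN v : v \in W -> y v \in N v.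
Proof.
move=> vW; rewrite /y; case: pickP => //= h.
by have /set0Pn [x] := N0 vW; rewrite h.
Qed.

Let hdW p : p \in W' -> hd p \in W.
Proof.
rewrite inE /hd => /andP [pW _]; case: p.2 => // _.
exact: (subsetP (NW pW)) (yN pW).
Qed.

Let N'W p : p \in W' -> N' p \subset W'.
Proof.
move=> /hdW pW; apply/subsetP => -[x j]; rewrite !inE /=.
case/orP => [/andP [xN /eqP ->] | /andP [/eqP -> jm]].
  by rewrite (subsetP (NW pW)).
by rewrite pW jm orbT.
Qed.

Let card_fresh v : #|fresh v| = m v.
Proof.
by rewrite card_imset ?card_ord_ltn ?leq_subr // => i j [].
Qed.

Let card_N' p : r <= #|N' p|.
Proof.
rewrite cardsU (_ : _ :&: _ = set0) ?cards0 ?subn0.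
  by rewrite !cardsX !cards1 card_fresh /m; lia.
apply/setP => -[x j]; rewrite !inE /=; apply/negP.
by case/andP => /andP [_ /eqP ->] /andP [_ /imsetP [j' _]].
Qed.

Let card_W' : #|W'| = \sum_(v in W) (1 + (r - #|N v|)).
Proof.
rewrite -sum1_card.
rewrite (eq_bigl (fun p : twin => (p.1 \in W) && (p.2 \in None |: fresh p.1))).
  rewrite -(pair_big_dep (fun v => v \in W) (fun v o => o \in None |: fresh v)
    (fun _ _ => 1)).
  apply: eq_bigr => v vW; rewrite sum1_card cardsU1 card_fresh.
  by case: imsetP => //= -[].
by move=> p; rewrite inE.
Qed.

Let hd_walk k p q : p \in W' -> dwalk N' k p q -> dwalk N k (hd p) (hd q).
Proof.
elim: k p => [|k IHk] p pW /=; first by move/eqP->.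
case/existsP => x /andP [xN xq]; apply/existsP; exists (hd x).
rewrite (IHk x) ?(subsetP (N'W pW)) ?andbT //.
case: x xN {xq} => x j; rewrite !inE /hd /=.
case/orP => [/andP [xN /eqP ->] | /andP [/eqP -> /imsetP [j' _ ->]]] //.
exact: yN (hdW pW).
Qed.

(* Each missing out-neighbour of [v] is replaced by a copy of one fixed
   out-neighbour of [v], with the same out-neighbourhood. *)
Lemma twins : exists (T' : finType) (V' : {set T'}) (M : T' -> {set T'}),
  [/\ forall p, p \in V' -> M p \subset V', forall p, p \in V' -> r <= #|M p|,
    #|V'| = \sum_(v in W) (1 + (r - #|N v|)) &
    forall k, dclosed M V' k -> dclosed N W k].
Proof.
exists twin, W', N'; split=> // k /andP [k0 /existsP [p /andP [pW pp]]].
rewrite /dclosed k0 /=; apply/existsP; exists (hd p).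
by rewrite hdW //= hd_walk.
Qed.

End Twins.

(** * Closed walks of length at most [(n + c) / r] when all out-degrees are at least [r] *)

Section MinimalOutDegree.
Variables r c : nat.
Hypothesis r2 : 2 <= r.
Hypothesis c4 : 4 * r <= c.
Hypothesis c3 : r * (2 * (r * r)) + 2 * r <= c.

Let bound n := n + c.

Let girth_upto n := forall (T : finType) (W : {set T}) (N : T -> {set T}),
  W != set0 -> (forall v, v \in W -> N v \subset W) ->
  (forall v, v \in W -> r <= #|N v|) -> #|W| <= n ->
  exists2 k, dclosed N W k & r * k <= bound #|W|.

Let girth_deficient n (T : finType) (W : {set T}) (N : T -> {set T}) :
  girth_upto n -> W != set0 -> (forall v, v \in W -> N v \subset W) ->
  (forall v, v \in W -> N v != set0) ->
  \sum_(v in W) (1 + (r - #|N v|)) <= n ->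
  exists2 k, dclosed N W k & r * k <= bound (\sum_(v in W) (1 + (r - #|N v|))).
Proof.
move=> IH W0 NW N0 hn; have [T' [V' [M [MV Mr cV clos]]]] := twins r NW N0.
have V0 : V' != set0.
  rewrite -card_gt0 cV; have /set0Pn [v vW] := W0.
  by rewrite (bigD1 v).
have [|k kc kb] := IH _ _ _ V0 MV Mr; first by rewrite cV.
by exists k; [exact: clos | rewrite -cV].
Qed.

Section Step.
Variables (n : nat) (T : finType) (W : {set T}) (N : T -> {set T}).
Hypothesis IH : girth_upto n.
Hypothesis NW : forall v, v \in W -> N v \subset W.
Hypothesis Nr : forall v, v \in W -> r <= #|N v|.
Hypothesis cW : #|W| = n.+1.
Hypothesis long : forall k, dclosed N W k -> bound n.+1 < r * k.

Let no_loop v : v \in W -> v \notin N v.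
Proof.
move=> vW; apply/negP => vN; suff /long : dclosed N W 1.
  by rewrite /bound; move: c4 r2; clear; lia.
by apply/andP; split=> //; apply/existsP; exists v; rewrite vW dwalk1.
Qed.

Let no_digon u v : u \in W -> v \in N u -> u \notin N v.
Proof.
move=> uW vN; apply/negP => uN; suff /long : dclosed N W 2.
  by rewrite /bound; move: c4 r2; clear; lia.
apply/andP; split=> //; apply/existsP; exists u; rewrite uW.
exact: (dwalk_cat (i := 1) (j := 1) (dwalk1 vN) (dwalk1 uN)).
Qed.

(** A smaller such [X] would carry a digraph to which [IH] applies, and its short closed walk is
    also one of [N]. *)
Let closed_all (X : {set T}) :
  X \subset W -> X != set0 -> (forall v, v \in X -> N v \subset X) -> X = W.
Proof.
move=> XW X0 NX; apply/eqP; rewrite eqEcard XW /= cW leqNgt; apply/negP => cX.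
have [||k kc kb] := IH X0 NX; first by move=> v vX; apply/Nr/(subsetP XW).
  by [].
have /long : dclosed N W k.
  apply: dclosed_mono kc => // v vX.
  by apply/subsetP => x xN; rewrite inE xN (subsetP (NX _ vX)).
by move: kb cX; rewrite /bound; lia.
Qed.

(** Otherwise delete [v] with its in-neighbors and let every vertex that loses an out-neighbor
    inherit those of [v]. At least [2 * r] vertices disappear, so [IH] gives a closed walk two steps
    shorter than what is allowed, and undoing the new arcs costs at most two steps. *)
Let indeg v : v \in W -> #|[set u in W | v \in N u]| <= 2 * r - 2.
Proof.
move=> vW; set I := [set u in W | _]; rewrite leqNgt; apply/negP => cI.
pose S := v |: I; pose W1 := W :\: S.
have vI : v \notin I by rewrite inE vW no_loop.
have SW : S \subset W.
  by apply/subsetP => x; rewrite !inE => /orP [/eqP -> | /andP []].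
have NvS : N v \subset W1.
  apply/subsetP => x xN; rewrite !inE (subsetP (NW vW)) // andbT negb_or.
  apply/andP; split; last by rewrite negb_and (no_digon vW xN) orbT.
  by apply: contraTneq xN => ->; exact: no_loop.
pose bad u := N u :&: S != set0.
pose N1 u := (N u :\: S) :|: (if bad u then N v else set0).
have W10 : W1 != set0.
  rewrite -card_gt0; apply: leq_trans (subset_leq_card NvS).
  by apply: leq_trans (Nr vW); apply: ltnW.
have N1W u : u \in W1 -> N1 u \subset W1.
  case/setDP => uW uS; rewrite subUset; apply/andP; split.
    by apply: setSD; exact: NW.
  by case: ifP => // _; exact: sub0set.
have N1r u : u \in W1 -> r <= #|N1 u|.
  case/setDP => uW uS; rewrite /N1; case: ifP => [_ | /negbFE/eqP h].
    by apply: leq_trans (Nr vW) (subset_leq_card (subsetUr _ _)).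
  rewrite setU0 setDE (_ : N u :&: ~: S = N u) ?Nr //.
  by apply/setIidPl; rewrite -disjoints_subset -setI_eq0 h.
have cS : 2 * r <= #|S| by rewrite cardsU1 vI; move: cI r2; clear; lia.
have cW1 : #|W1| + #|S| = n.+1.
  by rewrite cardsD (setIidPr SW) cW subnK // -cW subset_leq_card.
have [|k /andP [k0 /existsP [u /andP [uW1 uu]]] kb] := IH W10 N1W N1r.
  by move: cW1 cS r2; clear; lia.
have uW : u \in W by case/setDP: uW1.
have new a x : a \in W1 -> x \in N1 a -> x \notin N a -> bad a && (x \in N v).
  rewrite /N1 => aW1 /setUP [/setDP [-> //] |].
  by case: ifP => //; rewrite inE.
have short j : 0 < j -> j <= k.+2 -> forall b, b \in W -> dwalk N j b b -> False.
  move=> j0 jk b bW bb; suff /long : dclosed N W j.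
    rewrite /bound => h; move: kb; rewrite /bound => kb.
    have := leq_mul (leqnn r) jk; rewrite !mulnS.
    by move: h kb cS cW1; clear; lia.
  by apply/andP; split=> //; apply/existsP; exists b; rewrite bW.
(* Only old arcs are used from [b], the head of the last new arc, around to [a], the tail of the
   first. Then [a] reaches [v] in at most two old steps, and [v] reaches [b] in one. *)
have [h | [i [j [a [b [ij /andP [aB aW1] bN ua bu]]]]]] :=
  dwalk_split N1W new uW1 uu.
  exact: (short k k0 (leqW (leqnSn k)) u uW h).
have ba := dwalk_cat bu ua.
have aW : a \in W by case/setDP: aW1.
have [l [l0 l2 av]] : exists l, [/\ 0 < l, l <= 2 & dwalk N l a v].
  have /set0Pn [x /setIP [xN]] := aB; rewrite in_setU1 => /orP [/eqP xv | xI].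
    by exists 1; split=> //; apply: dwalk1; rewrite -xv.
  exists 2; split=> //; apply: (dwalk_cat (i := 1) (j := 1) (dwalk1 xN)).
  by apply: dwalk1; move: xI; rewrite inE => /andP [].
apply: (short (j + i + (l + 1)) _ _ b).
- by rewrite addn1 addnS.
- by move: ij l2; clear; lia.
- exact: (subsetP (NW vW)).
- apply: (dwalk_cat ba); apply: (dwalk_cat av); exact: dwalk1.
Qed.

Let out (X : {set T}) := X :|: \bigcup_(v in X) N v.

Let outW (X : {set T}) : X \subset W -> out X \subset W.
Proof.
move=> XW; rewrite subUset XW; apply/bigcupsP => v vX.
exact/NW/(subsetP XW).
Qed.

(** If fewer than [r] vertices are gained, the bound on in-degrees leaves at most [2 * r ^ 2] arcs
    from [X] to them. The digraph induced on [X] is then so little deficient that [girth_deficient]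
    applies, unless [X] nearly fills [W]. *)
Let out_grows (X : {set T}) : X \subset W -> X != set0 ->
  r + #|X| <= #|out X| \/ n.+1 <= #|X| + 2 * (r * r).
Proof.
move=> XW X0; case: (leqP (r + #|X|) #|out X|) => small; first by left.
right; rewrite leqNgt; apply/negP => cX; pose S := out X :\: X.
have outE : #|X| + #|S| = #|out X|.
  by rewrite cardsDS ?subsetUl // subnKC // subset_leq_card ?subsetUl.
have NS v : v \in X -> N v :\: X \subset S.
  by move=> vX; apply/setSD/subsetU; rewrite (bigcup_max v) ?orbT.
have M0 v : v \in X -> N v :&: X != set0.
  move=> vX; apply/negP => /eqP h; have := subset_leq_card (NS v vX).
  rewrite (_ : N v :\: X = N v); last by apply/setDidPl; rewrite -setI_eq0 h.
  by have := Nr (subsetP XW _ vX); move: outE small; clear; lia.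
have lost : \sum_(v in X) (1 + (r - #|N v :&: X|)) <= #|X| + 2 * (r * r).
  rewrite big_split /= sum1_card leq_add2l.
  apply: (@leq_trans (\sum_(v in X) #|N v :&: S|)).
    apply: leq_sum => v vX; have := Nr (subsetP XW _ vX).
    rewrite -(cardsID X (N v)) => h; rewrite leq_subLR (leq_trans h) // leq_add2l.
    by apply: subset_leq_card; rewrite subsetI subsetDl NS.
  have -> : \sum_(v in X) #|N v :&: S| = \sum_(s in S) #|[set v in X | s \in N v]|.
    rewrite (eq_bigr (fun v => \sum_(s in S) (s \in N v))); last first.
      move=> v _; rewrite -sum1_card big_mkcond [RHS]big_mkcond /=.
      by apply: eq_bigr => s _; rewrite inE andbC; case: (s \in S) (s \in N v) => [] [].
    rewrite exchange_big /=; apply: eq_bigr => s _.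
    rewrite -sum1_card big_mkcond [RHS]big_mkcond /=.
    by apply: eq_bigr => v _; rewrite inE; case: (v \in X) (s \in N v) => [] [].
  apply: (@leq_trans (\sum_(s in S) (2 * r - 2))).
    apply: leq_sum => s /setDP [sX _].
    apply: leq_trans (indeg (subsetP (outW XW) _ sX)); apply: subset_leq_card.
    by apply/subsetP => v; rewrite !inE => /andP [/(subsetP XW) -> ->].
  rewrite sum_nat_const; apply: (@leq_trans (r * (2 * r))).
    by apply: leq_mul; [move: outE small; clear; lia | exact: leq_subr].
  by rewrite mulnCA.
have MX v : v \in X -> N v :&: X \subset X by move=> _; exact: subsetIr.
have [|k kc kb] := girth_deficient IH X0 MX M0; first by move: lost cX; clear; lia.
have /long : dclosed N W k.
  by apply: dclosed_mono kc => // v vX.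
by move: kb lost cX; rewrite /bound; clear; lia.
Qed.

(** Balls around an out-neighbor [x] of [v] gain [r] vertices per step until at most [2 * r ^ 2] are
    missing, and at least one per step from then on. Once [v] is reached, the arc from [v] to [x]
    closes the walk; [c3] pays for the slow steps, the rounding and the closing arc. *)
Lemma no_long_girth : False.
Proof.
have /set0Pn [v vW] : W != set0 by rewrite -card_gt0 cW.
have /set0Pn [x xN] : N v != set0.
  by rewrite -card_gt0; apply: leq_trans (Nr vW); apply: ltnW.
have xW : x \in W := subsetP (NW vW) _ xN.
pose B p := iter p out [set x].
have BW p : B p \subset W by elim: p => [|p IHp]; rewrite /= ?sub1set ?outW.
have xB p : x \in B p.
  by elim: p => [|p IHp]; [exact: set11 | apply/setUP; left].
have B0 p : B p != set0 by apply/set0Pn; exists x.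
have walkB p w : w \in B p -> exists2 k, k <= p & dwalk N k x w.
  elim: p w => [|p IHp] w; first by move/set1P->; exists 0 => //=.
  case/setUP => [/IHp [k kp xw] | /bigcupP [u /IHp [k kp xu] wN]].
    by exists k => //; exact: leqW.
  by exists (k + 1); [rewrite addn1 | apply: dwalk_cat xu (dwalk1 wN)].
have fast p : 1 + r * p <= #|B p| \/ n.+1 <= #|B p| + 2 * (r * r).
  elim: p => [|p [h|h]]; first by left; rewrite cards1 muln0.
    have [h'|h'] := out_grows (BW p) (B0 p).
      by left; rewrite mulnS; move: h h'; clear; rewrite /B /=; lia.
    right; apply: leq_trans h' _; rewrite leq_add2r.
    by apply: subset_leq_card; exact: subsetUl.
  right; apply: leq_trans h _; rewrite leq_add2r.
  by apply: subset_leq_card; exact: subsetUl.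
have slow p : #|B p| < #|B p.+1| \/ B p = W.
  have [sub|nsub] := boolP (out (B p) \subset B p).
    right; apply: closed_all => // w wB; apply: subset_trans sub.
    by apply: subsetU; rewrite (bigcup_max w) ?orbT.
  by left; apply: proper_card; rewrite properE subsetUl.
(* The successor makes [r * p1] exceed [n.+1], which excludes the first alternative of [fast]. *)
pose p1 := (n.+1 %/ r).+1.
have p1b : r * p1 <= n.+1 + r.
  by rewrite mulnS addnC leq_add2r mulnC leq_divM.
have bigp1 : n.+1 <= #|B p1| + 2 * (r * r).
  have [h|//] := fast p1; have := subset_leq_card (BW p1); rewrite cW => h'.
  have : n.+1 < r * p1 by rewrite mulnC ltn_ceil // ltnW.
  by move: h h'; clear; lia.
have all q : B (p1 + q) = W \/ #|B p1| + q <= #|B (p1 + q)|.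
  elim: q => [|q [h|h]]; first by right; rewrite !addn0.
    left; apply/eqP; rewrite eqEsubset BW addnS -h; exact: subsetUl.
  have [h'|h'] := slow (p1 + q); first by right; rewrite !addnS (leq_ltn_trans h).
  by left; apply/eqP; rewrite eqEsubset BW addnS -h'; exact: subsetUl.
pose q := 2 * (r * r).
have BqW : B (p1 + q) = W.
  have [//|h] := all q; apply/eqP; rewrite eqEcard BW cW.
  exact: leq_trans bigp1 h.
have [k kp xv] : exists2 k, k <= p1 + q & dwalk N k x v.
  by apply: walkB; rewrite BqW.
have /long : dclosed N W (1 + k).
  apply/andP; split=> //; apply/existsP; exists v; rewrite vW.
  exact: dwalk_cat (dwalk1 xN) xv.
have := leq_mul (leqnn r) kp; move: p1b c3 r2; rewrite /bound mulnDr mulnDr /q.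
by clear; lia.
Qed.

End Step.

Lemma girth_min_outdegree n : girth_upto n.
Proof.
elim: n => [|n IH] T W N W0 NW Nr; first by rewrite leqn0 cards_eq0 (negPf W0).
rewrite leq_eqVlt => /orP [/eqP cW | ]; last by rewrite ltnS; exact: IH.
rewrite cW; set m := bound n.+1.
(* Since [0 < r], a suitable [k] is at most [m], so its existence is a finite boolean search. *)
have [/existsP [k /andP [kc kb]] | none] :=
  boolP [exists k : 'I_m.+1, dclosed N W k && (r * k <= m)]; first by exists k.
exfalso; apply: (no_long_girth IH NW Nr cW) => k kc.
rewrite ltnNge; apply: contra none => kb.
have km : k < m.+1 by rewrite ltnS (leq_trans _ kb) // leq_pmull // ltnW.
by apply/existsP; exists (Ordinal km); rewrite /= kc kb.
Qed.

Lemma girth_deficiency (T : finType) (W : {set T}) (N : T -> {set T}) :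
  W != set0 -> (forall v, v \in W -> N v \subset W) ->
  (forall v, v \in W -> N v != set0) ->
  exists2 k, dclosed N W k & r * k <= \sum_(v in W) (1 + (r - #|N v|)) + c.
Proof.
by move=> W0 NW N0; apply: girth_deficient (girth_min_outdegree (n := _)) _ _ _ _.
Qed.

End MinimalOutDegree.

(** * Rainbow walks and clusters *)

Section RainbowWalks.
Variables V C : finType.
Implicit Types (E : C -> {set {set V}}) (K : {set C}) (u v w x y : V) (c : C).
Implicit Types (s : seq (C * V)).

(** Each entry of [s] holds the color and the head of one step. Edges are plain vertex sets, so
    parallel edges can occur only in different colors. *)
Fixpoint cwalk E u s :=
  if s is (c, x) :: s' then ([set u; x] \in E c) && cwalk E x s' else true.

Definition rwalk E K u s v :=
  [&& cwalk E u s, last u (unzip2 s) == v, uniq (unzip1 s) &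
      all (mem K) (unzip1 s)].

Definition rconn E K l u v := exists2 s, rwalk E K u s v & size s <= l.

Definition rcyc E K l := exists u s, [/\ rwalk E K u s u, 0 < size s & size s <= l].

Lemma cwalk_cat E u s1 s2 :
  cwalk E u (s1 ++ s2) = cwalk E u s1 && cwalk E (last u (unzip2 s1)) s2.
Proof. by elim: s1 u => [|[c x] s IHs] u //=; rewrite IHs andbA. Qed.

Lemma rwalk_cat E K1 K2 u v w s1 s2 : [disjoint K1 & K2] ->
  rwalk E K1 u s1 v -> rwalk E K2 v s2 w -> rwalk E (K1 :|: K2) u (s1 ++ s2) w.
Proof.
move=> dis /and4P [w1 /eqP l1 u1 /allP a1] /and4P [w2 /eqP l2 u2 /allP a2].
apply/and4P; split.
- by rewrite cwalk_cat w1 l1.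
- by rewrite /unzip2 map_cat last_cat -/(unzip2 _) l1 -/(unzip2 _) l2.
- rewrite /unzip1 map_cat cat_uniq -!/(unzip1 _) u1 u2 andbT /=.
  apply/hasPn => c cs2; apply/negP => cs1.
  have c1 : c \in K1 := a1 _ cs1; have c2 : c \in K2 := a2 _ cs2.
  by move: (disjointFr dis c1); rewrite c2.
- rewrite /unzip1 map_cat all_cat -!/(unzip1 _); apply/andP.
  by split; apply/allP => c cs; apply/setUP; [left; exact: a1 | right; exact: a2].
Qed.

Lemma rwalk_sub E K K' u s v : K \subset K' -> rwalk E K u s v -> rwalk E K' u s v.
Proof.
move=> sub /and4P [w1 l1 u1 /allP a1]; apply/and4P; split=> //.
by apply/allP => c /a1; exact: (subsetP sub).
Qed.

Lemma rcyc_mono E E' K l : (forall c, c \in K -> E c \subset E' c) ->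
  rcyc E K l -> rcyc E' K l.
Proof.
move=> sub [u [s [/and4P [w1 l1 u1 a1] s0 sl]]]; exists u, s; split=> //.
apply/and4P; split=> //; elim: s u w1 a1 {l1 u1 s0 sl} => //= -[c x] s IHs u.
case/andP => e w1 /andP [cK a1]; rewrite IHs // andbT.
exact: (subsetP (sub _ cK)).
Qed.

Lemma rconn0 E K l u : rconn E K l u u.
Proof. by exists [::] => //; rewrite /rwalk /= eqxx. Qed.

Lemma rconn1 E c u x : [set u; x] \in E c -> rconn E [set c] 1 u x.
Proof. by move=> h; exists [:: (c, x)] => //; rewrite /rwalk /= h eqxx inE eqxx. Qed.

Lemma rconn_sub E K K' l l' u v :
  K \subset K' -> l <= l' -> rconn E K l u v -> rconn E K' l' u v.
Proof.
by move=> sub ll [s sw sl]; exists s; [exact: rwalk_sub sub sw | exact: leq_trans ll].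
Qed.

Lemma rconn_cat E K1 K2 l1 l2 u v w : [disjoint K1 & K2] ->
  rconn E K1 l1 u v -> rconn E K2 l2 v w -> rconn E (K1 :|: K2) (l1 + l2) u w.
Proof.
move=> dis [s1 w1 h1] [s2 w2 h2]; exists (s1 ++ s2); first exact: rwalk_cat w1 w2.
by rewrite size_cat leq_add.
Qed.

(** The first color is taken out of [K] before the rest is reversed, so that appending it at the end
    keeps the walk rainbow. *)
Lemma rconn_sym E K l u v : rconn E K l u v -> rconn E K l v u.
Proof.
case=> s; elim: s K l u => [|[c x] s IHs] K l u.
  by case/and4P => _ /= /eqP -> _ _ _; exact: rconn0.
case/and4P => /= /andP [cE sw] sl /andP [cs su] /andP [cK sK]; case: l => // l sz.
have xv : rwalk E (K :\ c) x s v.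
  apply/and4P; split=> //; apply/allP => d ds; apply/setD1P.
  by split; [apply: contraNneq cs => <- | exact: (allP sK)].
have cK' : c \in K := cK.
have dis : [disjoint K :\ c & [set c]].
  by rewrite disjoint_sym disjoints1 !inE eqxx.
have h1 : rconn E [set c] 1 x u by apply: rconn1; rewrite setUC.
rewrite -(setD1K cK') setUC -addn1; exact: rconn_cat dis (IHs _ l _ xv sz) h1.
Qed.

Lemma rcyc_sub E K K' l l' : K \subset K' -> l <= l' -> rcyc E K l -> rcyc E K' l'.
Proof.
move=> sub ll [u [s [sw s0 sl]]]; exists u, s; split=> //; last exact: leq_trans ll.
exact: rwalk_sub sub sw.
Qed.

Lemma rcyc_edge E K c l x y : c \notin K -> [set x; y] \in E c ->
  rconn E K l y x -> rcyc E (c |: K) l.+1.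
Proof.
move=> cK cE [s sw sl]; exists x, ((c, y) :: s); split=> //.
rewrite -cat1s; apply: rwalk_cat sw; first by rewrite disjoints1.
by rewrite /rwalk /= cE eqxx inE eqxx.
Qed.

(** A repeated vertex cuts off a shorter closed walk, whose colors form a subsequence and hence stay
    distinct. *)
Lemma rcyc_simple E K l : rcyc E K l ->
  exists u s, [/\ rwalk E K u s u, 0 < size s, size s <= l & uniq (unzip2 s)].
Proof.
case=> u [s [sw s0 sl]]; have [m] := ubnP (size s).
elim: m u s sw s0 sl => // m IHm u s sw s0 sl; rewrite ltnS => sm.
have [us | ] := boolP (uniq (unzip2 s)); first by exists u, s.
case/(uniqPn u) => i [j [ij]]; rewrite size_map => js nij.
have is_ : i < size s := ltn_trans ij js.
(* [unzip2 s] lists heads of steps, so the part between two equal heads [i] and [j] starts with step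
   [i.+1]. *)
pose s2 := drop i.+1 (take j.+1 s).
have s2sz : size s2 = j - i.
  by rewrite size_drop size_takel // subSS.
have sE : s = take i.+1 s ++ (s2 ++ drop j.+1 s).
  rewrite -[LHS](cat_take_drop j.+1) -[X in X ++ _ = _](cat_take_drop i.+1).
  by rewrite take_takel 1?ltnW // -catA.
have lastE k : k < size s -> last u (unzip2 (take k.+1 s)) = nth u (unzip2 s) k.
  move=> ks; rewrite (last_nth u) size_map size_takel //=.
  by rewrite -[in RHS](cat_take_drop k.+1 s) /unzip2 map_cat nth_cat size_map size_takel // ltnSn.
case/and4P: (sw) => s_w s_l s_u s_a.
have w2 : rwalk E K (nth u (unzip2 s) i) s2 (nth u (unzip2 s) i).
  have sub : subseq s2 s by rewrite (subseq_trans (drop_subseq _ _)) ?take_subseq.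
  apply/and4P; split.
  - move: s_w; rewrite {1}sE cwalk_cat (lastE i is_) cwalk_cat.
    by case/and3P.
  - have := lastE j js; rewrite -[take j.+1 s](cat_take_drop i.+1) -/s2.
    rewrite take_takel 1?ltnW // /unzip2 map_cat last_cat -!/(unzip2 _).
    by rewrite lastE // => ->; rewrite nij.
  - by apply: subseq_uniq s_u; apply: map_subseq.
  - by apply/allP => c /(mem_subseq (map_subseq _ sub)); exact: (allP s_a).
have j_i : j - i < size s by apply: leq_ltn_trans (leq_subr _ _) js.
apply: IHm w2 _ _ _.
- by rewrite s2sz subn_gt0.
- by rewrite s2sz (leq_trans (ltnW j_i)).
- by rewrite s2sz (leq_trans j_i).
Qed.

End RainbowWalks.

(** * Clusters and their growth *)

Section Clusters.
Variables (V C : finType) (r : nat).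
Implicit Types (E : C -> {set {set V}}) (B W : {set V}) (K U : {set C}).

Definition weight E U := \sum_(c in U) (r.+1 - #|E c|).

Definition classes E W K :=
  [/\ forall c e, c \in K -> e \in E c -> #|e| = 2,
      forall c e, c \in K -> e \in E c -> e \subset W
    & forall c, c \in K -> 0 < #|E c| <= r].

(** As in a tree, there is one color fewer than vertices, so contracting [B] to a point and dropping
    [U] preserves the excess of colors over vertices. *)
Definition cluster E W K B U t :=
  [/\ B \subset W, U \subset K, #|B| = #|U|.+1
    & forall u v, u \in B -> v \in B -> rconn E U t u v].

Definition leaving E K B U :=
  [set c in K :\: U | [exists e in E c, e :&: B != set0]].

(** These are the classes that the contraction of [B] would collapse to a single edge at [x]. *)
Definition swallows E B x c :=
  [forall e in E c, [exists b in B, e == [set x; b]]].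

Definition saturated E W K B U :=
  forall c x, c \in K :\: U -> x \in W :\: B -> ~~ swallows E B x c.

Variables (E : C -> {set {set V}}) (W : {set V}) (K : {set C}).
Hypothesis EWK : classes E W K.

Lemma edge_pair c e b : c \in K -> e \in E c -> b \in e ->
  exists x, [/\ e = [set b; x], x != b, b \in W & x \in W].
Proof.
case: EWK => E2 EW _ cK eE be; have := E2 _ _ cK eE.
rewrite (cardsD1 b) be => -[/eqP/cards1P [x xe]].
have e2 : e = [set b; x] by rewrite -xe setD1K.
have /setD1P [xb x_e] : x \in e :\ b by rewrite xe set11.
by exists x; split=> //; apply: (subsetP (EW _ _ cK eE)).
Qed.

Lemma edge_neq c x y : c \in K -> [set x; y] \in E c -> x != y.
Proof.
case: EWK => E2 _ _ cK eE; have := E2 _ _ cK eE.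
by rewrite cards2; case: eqP.
Qed.

Lemma weight_sub U U' : U \subset U' -> weight E U <= weight E U'.
Proof.
by move=> sub; rewrite /weight [X in _ <= X](big_setID U) /= (setIidPr sub) leq_addr.
Qed.

Lemma weightU U U' : [disjoint U & U'] ->
  weight E (U :|: U') = weight E U + weight E U'.
Proof.
by move=> dis; rewrite /weight -bigU //=; apply: eq_bigl => c; rewrite !inE.
Qed.

Lemma weight_card U : U \subset K -> #|U| <= weight E U.
Proof.
case: EWK => _ _ Er UK; rewrite -sum1_card; apply: leq_sum => c cU.
by have /andP [_ h] := Er _ (subsetP UK _ cU); rewrite subn_gt0 ltnS.
Qed.

Lemma cluster1 v : v \in W -> cluster E W K [set v] set0 0.
Proof.
move=> vW; split; rewrite ?sub1set ?sub0set ?cards1 ?cards0 //.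
by move=> x y /set1P -> /set1P ->; exact: rconn0.
Qed.

Section Around.
Variables (B : {set V}) (U : {set C}) (t : nat).
Hypothesis clB : cluster E W K B U t.

Lemma no_inner_edge c x y : ~ rcyc E K t.+1 -> c \in K :\: U ->
  x \in B -> y \in B -> [set x; y] \notin E c.
Proof.
case: clB => BW UK _ conn nocyc /setDP [cK cU] xB yB; apply/negP => cE.
apply: nocyc; apply: rcyc_sub (rcyc_edge cU cE (conn _ _ yB xB)) => //.
by rewrite subUset sub1set cK.
Qed.

Lemma leaving_edge c : ~ rcyc E K t.+1 -> c \in leaving E K B U ->
  exists b x, [/\ b \in B, x \in W :\: B & [set b; x] \in E c].
Proof.
move=> nocyc; rewrite inE => /andP [cKU /existsP [e /andP [eE]]].
case/set0Pn => b /setIP [be bB]; have cK : c \in K by case/setDP: cKU.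
have [x [ex xb bW xW]] := edge_pair cK eE be; exists b, x; split=> //.
  rewrite inE xW andbT; apply: contraL eE => xB; rewrite ex.
  exact: no_inner_edge.
by rewrite -ex.
Qed.

(** Two different colors reaching [x] would close a cycle of length [t.+2] through the cluster. *)
Lemma one_color_outside c c' b b' x : ~ rcyc E K t.+2 ->
  c \in K :\: U -> c' \in K :\: U -> b \in B -> b' \in B ->
  [set b; x] \in E c -> [set b'; x] \in E c' -> c = c'.
Proof.
case: clB => BW UK _ conn nocyc /setDP [cK cU] /setDP [cK' cU'] bB bB' e e'.
apply/eqP; apply/negPn/negP => cc; apply: nocyc.
have dis : [disjoint U & [set c']] by rewrite disjoint_sym disjoints1.
have path := rconn_cat dis (conn _ _ bB bB') (rconn1 e').
have cU2 : c \notin U :|: [set c'] by rewrite !inE negb_or cU.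
apply: rcyc_sub (rcyc_edge cU2 _ (rconn_sym path)).
- by rewrite !subUset !sub1set cK UK cK'.
- by rewrite addn1.
- by [].
Qed.

(** One edge is chosen for each leaving color. By [one_color_outside] the outer ends are distinct,
    so vertices and colors increase equally, and the diameter grows by one step at each end. *)
Lemma cluster_grow : ~ rcyc E K t.+2 -> exists B' U',
  [/\ cluster E W K B' U' t.+2, B \subset B', U' = U :|: leaving E K B U
    & #|B'| = #|B| + #|leaving E K B U|].
Proof.
move=> nocyc; have nocyc1 : ~ rcyc E K t.+1.
  by move=> h; apply: nocyc; apply: rcyc_sub h.
set L := leaving E K B U; case: clB => BW UK cB conn.
have LKU : L \subset K :\: U by apply/subsetP => c; rewrite inE => /andP [].
pose out c x := [exists b in B, [set b; x] \in E c] && (x \in W :\: B).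
have [f fP] : {f : C -> option V | forall c, c \in L -> exists2 x, f c = Some x & out c x}.
  exists (fun c => [pick x | out c x]) => c cL; case: pickP => [x ox | none].
    by exists x.
  have [b [x [bB xWB bx]]] := leaving_edge nocyc1 cL.
  by have := none x; rewrite /out xWB andbT => /existsP []; exists b; rewrite bB.
have [-> | /set0Pn [c0 c0L]] := eqVneq L set0.
  exists B, U; rewrite setU0 cards0 addn0; split=> //; split=> // u v uB vB.
  by apply: rconn_sub (conn _ _ uB vB) => //; rewrite !leqW.
(* [x0] is only a default that makes [g] total. *)
have [x0 _ _] := fP _ c0L; pose g c := odflt x0 (f c).
have gP c : c \in L -> out c (g c) by move=> /fP [x fx]; rewrite /g fx.
have g_inj : {in L &, injective g}.
  move=> c c' cL cL' gg; have /andP [/existsP [b /andP [bB be]] _] := gP _ cL.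
  have /andP [/existsP [b' /andP [bB' be']] _] := gP _ cL'.
  apply: (one_color_outside nocyc _ _ bB bB' be); try exact: (subsetP LKU).
  by rewrite gg.
have BL : [disjoint B & g @: L].
  rewrite -setI_eq0; apply/eqP/setP => x; rewrite !inE; apply/negP.
  case/andP => xB /imsetP [c /gP /andP [_ /setDP [_ xNB]] xE].
  by rewrite -xE xB in xNB.
have UL : [disjoint U & L].
  rewrite -setI_eq0; apply/eqP/setP => c; rewrite !inE; apply/negP.
  by case/andP => cU /andP [/andP [/negP]].
have hub c : c \in L -> exists2 b, b \in B & [set b; g c] \in E c.
  by move/gP => /andP [/existsP [b /andP []]]; exists b.
exists (B :|: g @: L), (U :|: L).
have cBL : #|B :|: g @: L| = #|B| + #|L|.
  by move: BL; rewrite -setI_eq0 => /eqP h; rewrite cardsU h cards0 subn0 card_in_imset.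
split=> //; last exact: subsetUl.
split.
- rewrite subUset BW; apply/subsetP => x /imsetP [c /gP /andP [_ /setDP [xW _]]].
  by move->.
- by rewrite subUset UK (subset_trans LKU) ?subsetDl.
- by move: UL; rewrite -setI_eq0 => /eqP h; rewrite cBL cardsU h cards0 subn0 cB.
(* A new vertex enters [B] by a color of its own, so distinct vertices never compete for a color. *)
have attach x : x \in B :|: g @: L ->
    exists (b : V) (X : {set C}) k, [/\ b \in B, X \subset L, k <= 1, rconn E X k x b &
      X = set0 \/ exists2 c, c \in L & X = [set c] /\ x = g c].
  case/setUP => [xB | /imsetP [c cL ->]].
    by exists x, set0, 0; split; rewrite ?sub0set //; [exact: rconn0 | left].
  have [b bB be] := hub _ cL; exists b, [set c], 1; split=> //.
  - by rewrite sub1set.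
  - exact/rconn_sym/rconn1.
  - by right; exists c.
move=> u v uB vB; have [-> | uv] := eqVneq u v; first exact: rconn0.
have [b [X [k [bB XL k1 ub Xe]]]] := attach _ uB.
have [b' [Y [l [bB' YL l1 vb Ye]]]] := attach _ vB.
have disX : [disjoint X & U] by rewrite disjoint_sym; apply: disjointWr UL.
have disY : [disjoint X :|: U & Y].
  rewrite disjoints_subset subUset -!disjoints_subset.
  rewrite [X in _ && X](disjointWr YL UL) andbT.
  case: Xe => [-> | [c cL [-> xc]]]; first by rewrite disjoints_subset sub0set.
  case: Ye => [-> | [d dL [-> yd]]].
    by rewrite disjoint_sym disjoints_subset sub0set.
  rewrite disjoints1 inE; apply: contraNneq uv => cd.
  by rewrite xc yd cd.
have := rconn_cat disY (rconn_cat disX ub (conn _ _ bB bB')) (rconn_sym vb).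
apply: rconn_sub.
  by rewrite !subUset subsetUl !(subset_trans _ (subsetUr _ _)).
by move: k1 l1; clear; lia.
Qed.

End Around.
End Clusters.

(** * Saturating a cluster at the price of the added weight *)

Section Saturation.
Variables (V C : finType) (r : nat).
Variables (E : C -> {set {set V}}) (W : {set V}) (K : {set C}).
Hypothesis r0 : 0 < r.
Hypothesis EWK : classes r E W K.
Variables (B : {set V}) (U : {set C}) (t : nat).
Hypothesis clB : cluster E W K B U t.

(* [rk] orders [Y] so that the class of [col y] joins [y] to [B] and to vertices
   of smaller rank only: [B] can swallow the vertices of [Y] one by one. *)
Definition draining (Y : {set V}) (col : V -> C) (rk : V -> nat) :=
  [/\ Y \subset W :\: B, {in Y &, injective col},
      forall y, y \in Y -> col y \in K :\: U
    & forall y e, y \in Y -> e \in E (col y) -> exists b,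
        [/\ b \in B :|: Y, e = [set y; b] & b \in Y -> rk b < rk y]].

Section Drain.
Variables (Y : {set V}) (col : V -> C) (rk : V -> nat).
Hypothesis drY : draining Y col rk.

(** Arcs go from [y] to the other ends of its own class. By rank they form an acyclic digraph on
    [B :|: Y] whose sinks are the vertices of [B]. *)
Let N y : {set V} :=
  if y \in Y then [set b in B :|: Y | [set y; b] \in E (col y)] else set0.

Let step (X : {set V}) := X :|: \bigcup_(x in X) N x.
Let out u p := iter p step [set u].
(** A walk from [u] within [out u p] takes its colors from the vertices it leaves, and these lie in
    the ball of radius one less. *)
Let inner u p := if p is p'.+1 then out u p' else set0.
Let cost x := r.+1 - #|E (col x)|.

Let YB : [disjoint Y & B].
Proof.
case: drY => YWB _ _ _; apply: disjointWl YWB _.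
by rewrite disjoints_subset setDE subsetIr.
Qed.

Let colK y : y \in Y -> col y \in K.
Proof. by case: drY => _ _ h _ /h /setDP []. Qed.

Let sub_step (X : {set V}) : X \subset step X. Proof. exact: subsetUl. Qed.

Let NY x b : b \in N x -> x \in Y.
Proof. by rewrite /N; case: ifP => //; rewrite inE. Qed.

Let N_BY x : N x \subset B :|: Y.
Proof.
rewrite /N; case: ifP => _; last exact: sub0set.
by apply/subsetP => b; rewrite inE => /andP [].
Qed.

Let N_rk x b : b \in N x -> b \in Y -> rk b < rk x.
Proof.
move=> bN bY; have xY := NY bN; case: drY => _ _ _ dr.
move: bN; rewrite /N xY inE => /andP [_ bE].
have [b' [_ e h]] := dr _ _ xY bE.
have bx := edge_neq EWK (colK xY) bE.
have : b \in [set x; b'] by rewrite -e !inE eqxx orbT.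
by rewrite !inE eq_sym (negPf bx) /= => /eqP bb; subst b'; exact: h.
Qed.

Let card_N y : y \in Y -> #|N y| = #|E (col y)|.
Proof.
move=> yY; case: drY => _ _ _ dr.
have inN b : (b \in N y) = (b \in B :|: Y) && ([set y; b] \in E (col y)).
  by rewrite /N yY inE.
have inj : {in N y &, injective (fun b => [set y; b])}.
  move=> b b'; rewrite !inN => /andP [_ be] _ /setP /(_ b).
  have := edge_neq EWK (colK yY) be.
  by rewrite !inE eqxx orbT [b == y]eq_sym => /negPf -> /esym /eqP.
rewrite -(card_in_imset inj); congr (#|pred_of_set _|); apply/setP => e.
apply/imsetP/idP => [[b] | eE]; first by rewrite inN => /andP [_ be] ->.
by have [b [bBY eb _]] := dr _ _ yY eE; exists b; rewrite // inN bBY -eb.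
Qed.

Let N_neq0 y : y \in Y -> exists b, b \in N y.
Proof.
move=> yY; apply/set0Pn; rewrite -card_gt0 card_N //.
by case: EWK => _ _ /(_ _ (colK yY)) /andP [].
Qed.

Let out_BY u p : u \in B :|: Y -> out u p \subset B :|: Y.
Proof.
move=> uBY; elim: p => [|p IHp]; first by rewrite sub1set.
by rewrite /= subUset IHp; apply/bigcupsP => x _; exact: N_BY.
Qed.

Let inner_sub u p : inner u p \subset out u p.
Proof. by case: p => [|p]; [exact: sub0set | exact: sub_step]. Qed.

Let out_conn u p x : x \in out u p ->
  rconn E (col @: (Y :&: inner u p)) p u x.
Proof.
elim: p x => [|p IHp] x; first by move/set1P->; exact: rconn0.
have [xo _ | xo] := boolP (x \in out u p).
  by apply: rconn_sub (IHp _ xo); rewrite ?imsetS ?setIS ?inner_sub.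
case/setUP => [xo' | /bigcupP [y yo xN]]; first by rewrite xo' in xo.
have yY := NY xN.
have yin : y \notin inner u p.
  apply: contra xo; case: p yo {IHp} => [|p] _; first by rewrite /inner inE.
  by move=> yo; apply/setUP; right; apply/bigcupP; exists y.
have yx : [set y; x] \in E (col y) by move: xN; rewrite /N yY inE => /andP [].
have dis : [disjoint col @: (Y :&: inner u p) & [set col y]].
  rewrite disjoint_sym disjoints1; apply/imsetP => -[z /setIP [zY zin]].
  by case: drY => _ inj _ _ /(inj _ _ yY zY) yz; rewrite yz zin in yin.
have := rconn_cat dis (IHp _ yo) (rconn1 yx); rewrite addn1; apply: rconn_sub => //.
rewrite subUset imsetS ?setIS ?inner_sub //= sub1set.
by apply/imsetP; exists y => //; apply/setIP.
Qed.

(* A lowest vertex of [out u p] sends its whole class outside [out u p]. *)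
Let out_grows u p : out u p \subset Y ->
  1 + r * p.+1 <= #|out u p.+1| + \sum_(x in out u p) (r - #|E (col x)|).
Proof.
have low q : out u q \subset Y -> exists x,
    [/\ x \in out u q, N x :&: out u q = set0
      & #|out u q| + #|E (col x)| <= #|out u q.+1|].
  move=> oY; have uo : u \in out u q.
    by elim: q {oY} => [|q IHq]; [exact: set11 | apply: (subsetP (sub_step _))].
  case: (arg_minnP rk uo) => x xo xmin; exists x.
  have Nx : N x :&: out u q = set0.
    apply/setP => b; rewrite !inE; apply/negP => /andP [bN bo].
    by have := N_rk bN (subsetP oY _ bo); rewrite ltnNge xmin.
  split=> //; rewrite -card_N ?(subsetP oY) //.
  have -> : #|out u q| + #|N x| = #|out u q :|: N x|.
    by rewrite cardsU setIC Nx cards0 subn0.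
  by apply/subset_leq_card/setUS/bigcup_sup.
have le_r x : x \in Y -> #|E (col x)| <= r.
  by case: EWK => _ _ Er /colK /Er /andP [].
elim: p => [|p IHp] oY.
  have [x [xo _ h]] := low 0 oY; move/set1P: (xo) => xu; subst x.
  have uY := subsetP oY _ xo; have := le_r _ uY; move: h.
  rewrite muln1 big_set1 /out /= cards1; clear; lia.
have oY' : out u p \subset Y by apply: subset_trans oY; exact: sub_step.
have [x [xo Nx h]] := low p.+1 oY; have xY := subsetP oY _ xo.
have xnew : x \notin out u p.
  apply/negP => xp; have [b bN] := N_neq0 xY.
  suff : b \in N x :&: out u p.+1 by rewrite Nx inE.
  by rewrite inE bN; apply/setUP; right; apply/bigcupP; exists x.
have sum : \sum_(y in out u p) (r - #|E (col y)|) + (r - #|E (col x)|) <=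
    \sum_(y in out u p.+1) (r - #|E (col y)|).
  rewrite [X in _ <= X](big_setID (out u p)) /= (setIidPr (sub_step _)) leq_add2l.
  by rewrite (bigD1 x) ?leq_addr //= inE xnew.
have := IHp oY'; rewrite [r * p.+2]mulnS; have := le_r _ xY; move: h sum; clear; lia.
Qed.

(** The cost of a vertex is 1 plus the shortfall of its class below [r]; what a layer lacks in new
    vertices is made up by a shortfall in the previous ball. *)
Let out_cost u p : out u p \subset Y -> 1 + r * p <= \sum_(x in out u p) cost x.
Proof.
move=> oY; have -> : \sum_(x in out u p) cost x =
    #|out u p| + \sum_(x in out u p) (r - #|E (col x)|).
  rewrite -sum1_card -big_split; apply: eq_bigr => x xo.
  have /andP [_ h] : 0 < #|E (col x)| <= r.
    by case: EWK => _ _ Er; apply/Er/colK/(subsetP oY).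
  by rewrite /cost subSn // add1n.
case: p oY => [|p] oY.
  by rewrite muln0 addn0 /= cards1.
apply: leq_trans (out_grows _) _; first by apply: subset_trans oY; exact: sub_step.
rewrite leq_add2l [X in _ <= X](big_setID (out u p)) /= (setIidPr (sub_step _)).
exact: leq_addr.
Qed.

Let inner_cost u p : inner u p \subset Y -> r * p <= \sum_(x in inner u p) cost x + r.
Proof.
case: p => [|p] oY; first by rewrite muln0.
by rewrite mulnS addnC leq_add2r; apply: leq_trans (out_cost oY); rewrite leq_addl.
Qed.

Let reach_B u : u \in B :|: Y -> exists p, out u p :&: B != set0.
Proof.
have [m] := ubnP (rk u); elim: m u => // m IHm u; rewrite ltnS => um.
case/setUP => [uB | uY].
  by exists 0; apply/set0Pn; exists u; rewrite !inE eqxx.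
have [b bN] := N_neq0 uY.
have outS p : out b p \subset out u p.+1.
  elim: p => [|p IHp].
    by rewrite sub1set; apply/setUP; right; apply/bigcupP; exists u; rewrite ?set11.
  rewrite /= subUset (subset_trans IHp (sub_step _)) /=.
  apply/bigcupsP => x xo; apply/subsetU/orP; right.
  by apply: (bigcup_max x) => //; apply: (subsetP IHp).
have bBY := subsetP (N_BY u) _ bN.
have [bY | bY] := boolP (b \in Y).
  have [|p pB] := IHm b _ bBY; first by apply: leq_trans (N_rk bN bY) um.
  by exists p.+1; apply: contraNneq pB => h; rewrite -subset0 -h setSI.
exists 1; apply/set0Pn; exists b; move: bBY; rewrite inE (negPf bY) orbF => bB.
by rewrite inE bB andbT; apply: (subsetP (outS 0)); exact: set11.
Qed.

Let first_reach u : u \in B :|: Y ->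
  exists2 p, out u p :&: B != set0 & inner u p \subset Y.
Proof.
move=> uBY; have := ex_minnP (reach_B uBY); case=> p pB pmin; exists p => //.
case: p pB pmin => [|p] pB pmin; first exact: sub0set.
apply/subsetP => x xo; move: (subsetP (out_BY p uBY) _ xo).
rewrite inE => /orP [xB | //]; suff /pmin : out u p :&: B != set0 by rewrite ltnn.
by apply/set0Pn; exists x; rewrite inE xB xo.
Qed.

(* Grow a ball around [u] and one around [v] until both reach [B] or they meet:
   before that they are disjoint, so the weights of their colours add up. *)
Lemma drain_conn u v : u \in B :|: Y -> v \in B :|: Y ->
  exists2 l, rconn E (U :|: col @: Y) (l + t) u v
    & r * l <= weight r E (col @: Y) + 2 * r.
Proof.
move=> uBY vBY.
pose ok p q := [&& inner u p \subset Y, inner v q \subset Y &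
  (out u p :&: out v q != set0) ||
  (out u p :&: B != set0) && (out v q :&: B != set0)].
have ex : exists m, [exists p : 'I_m.+1, ok p (m - p)].
  have [p pB pY] := first_reach uBY; have [q qB qY] := first_reach vBY.
  have pm : p < (p + q).+1 by rewrite ltnS leq_addr.
  exists (p + q); apply/existsP; exists (Ordinal pm).
  by rewrite /ok /= addKn pY qY pB qB orbT.
case: (ex_minnP ex) => m /existsP [[p pm] /= okp] mmin.
set q := m - p in okp; have mE : m = p + q by rewrite subnKC.
have [pY qY hit] := and3P okp.
(* If the inner balls met, both radii could be lowered by one, against the minimality of [m]. *)
have dis : inner u p :&: inner v q = set0.
  apply/eqP/negPn/negP; case: p q pY qY mE {pm okp hit} => [|p] [|q] pY qY mE;
    rewrite ?set0I ?setI0 ?eqxx //= => meet.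
  have pl : p < (p + q).+1 by rewrite ltnS leq_addr.
  suff /mmin : [exists p' : 'I_(p + q).+1, ok p' (p + q - p')].
    by rewrite mE; clear; lia.
  apply/existsP; exists (Ordinal pl); rewrite /ok /= addKn meet andbT.
  by rewrite !(subset_trans (inner_sub _ _)).
have wE : weight r E (col @: Y) = \sum_(x in Y) cost x.
  by case: drY => _ inj _ _; rewrite /weight big_imset.
have len : r * (p + q) <= weight r E (col @: Y) + 2 * r.
  rewrite mulnDr wE; have := inner_cost pY; have := inner_cost qY.
  have : \sum_(x in inner u p) cost x + \sum_(x in inner v q) cost x <=
      \sum_(x in Y) cost x.
    rewrite [X in _ <= X](big_setID (inner u p)) /= (setIidPr pY) leq_add2l.
    rewrite [X in _ <= X](big_setID (inner v q)) /= (setIidPr _) ?leq_addr //.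
    by rewrite subsetD qY -setI_eq0 setIC dis eqxx.
  by clear; lia.
exists (p + q) => //; case: drY => _ inj colKU _; case: clB => BW UK _ conn.
pose Xu := col @: (Y :&: inner u p); pose Xv := col @: (Y :&: inner v q).
have disX : [disjoint Xu & Xv].
  rewrite -setI_eq0; apply/eqP/setP => c; rewrite !inE; apply/negP.
  case/andP => /imsetP [x /setIP [xY xu] ->] /imsetP [y /setIP [yY yv] /inj xy].
  by have /setP /(_ x) := dis; rewrite !inE xu (xy xY yY) yv.
have disU (X : {set V}) : [disjoint U & col @: (Y :&: X)].
  rewrite -setI_eq0; apply/eqP/setP => c; rewrite !inE; apply/negP.
  case/andP => cU /imsetP [x /setIP [/colKU /setDP [_ xU] _] cx].
  by rewrite -cx cU in xU.
have subX (X : {set V}) : col @: (Y :&: X) \subset U :|: col @: Y.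
  by apply: subset_trans (subsetUr _ _); rewrite imsetS ?subsetIl.
case/orP: hit => [/set0Pn [y /setIP [yu yv]] | /andP [/set0Pn [b] /setIP [bu bB]]].
  have := rconn_cat disX (out_conn yu) (rconn_sym (out_conn yv)).
  by apply: rconn_sub; rewrite ?subUset ?subX ?leq_addr.
case/set0Pn => b' /setIP [bv bB'].
have dis1 : [disjoint Xu & U] by rewrite disjoint_sym disU.
have dis2 : [disjoint Xu :|: U & Xv].
  by rewrite disjoints_subset subUset -!disjoints_subset disX disU.
have := rconn_cat dis2 (rconn_cat dis1 (out_conn bu) (conn _ _ bB bB'))
  (rconn_sym (out_conn bv)).
by apply: rconn_sub; rewrite ?subUset ?subX ?subsetUl // addnAC.
Qed.

Lemma drain_cluster : exists2 t',
  cluster E W K (B :|: Y) (U :|: col @: Y) t' &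
  r * t' <= r * t + weight r E (col @: Y) + 2 * r.
Proof.
set w := weight _ _ _; exists (t + (w + 2 * r) %/ r).
  case: clB => BW UK cB _; case: drY => YWB inj colKU _; split.
  - by rewrite subUset BW (subset_trans YWB) ?subsetDl.
  - rewrite subUset UK; apply/subsetP => c /imsetP [y yY ->].
    by have /setDP [] := colKU _ yY.
  - have /eqP hY : B :&: Y == set0 by rewrite setIC setI_eq0; exact: YB.
    have /eqP hU : U :&: col @: Y == set0.
      apply/eqP/setP => c; rewrite !inE; apply/negP => /andP [cU /imsetP [y yY cy]].
      by have := colKU _ yY; rewrite -cy inE cU.
    by rewrite !cardsU hY hU !cards0 !subn0 card_in_imset // cB.
  - move=> u v uBY vBY; have [l lc lb] := drain_conn uBY vBY.
    by apply: rconn_sub lc; rewrite // addnC leq_add2l leq_divRL // mulnC.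
by rewrite mulnDr -addnA leq_add2l mulnC leq_divM.
Qed.

End Drain.

(** Vertices that swallow a color are added one at a time, each ranked above all others, until none
    is left outside. [c0] is a default color. *)
Lemma draining_saturated (c0 : C) : exists Y col rk,
  draining Y col rk /\ saturated E W K (B :|: Y) (U :|: col @: Y).
Proof.
suff ext m (Y : {set V}) col rk : #|W :\: (B :|: Y)| < m -> draining Y col rk ->
    exists Y' col' rk',
      draining Y' col' rk' /\ saturated E W K (B :|: Y') (U :|: col' @: Y').
  apply: (ext _ set0 (fun=> c0) (fun=> 0) (ltnSn _)).
  by split; rewrite ?sub0set // => y; rewrite inE.
elim: m Y col rk => // m IHm Y col rk; rewrite ltnS => sz drY.
have [h | ] := boolP [forall c in K :\: (U :|: col @: Y),
    [forall x in W :\: (B :|: Y), ~~ swallows E (B :|: Y) x c]].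
  exists Y, col, rk; split=> // c x cKU xW.
  by have /forall_inP /(_ _ cKU) /forall_inP := h; exact.
case/forall_inPn => c cKU /forall_inPn [x xWB /negPn /forall_inP sw].
pose col' y := if y == x then c else col y.
pose rk' y := if y == x then (\max_(z : V) rk z).+1 else rk y.
move/setDP: cKU => [cK]; rewrite inE negb_or => /andP [cU ccol].
move/setDP: (xWB) => [xW]; rewrite inE negb_or => /andP [xB xY].
have neqx y : y \in Y -> (y == x) = false.
  by move=> yY; apply: contraNF xY => /eqP <-.
case: (drY) => YWB inj colKU dr.
have dr' : draining (x |: Y) col' rk'.
  split.
  - by rewrite subUset sub1set inE xB xW.
  - move=> y z; rewrite !in_setU1 /col' => /orP [/eqP -> | yY] /orP [/eqP -> | zY] //;
      rewrite ?eqxx ?neqx // => cc.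
    + by case/negP: ccol; rewrite cc imset_f.
    + by case/negP: ccol; rewrite -cc imset_f.
    + exact: inj.
  - move=> y; rewrite in_setU1 /col' => /orP [/eqP -> | yY].
      by rewrite eqxx inE cU cK.
    by rewrite neqx ?colKU.
  - move=> y e; rewrite in_setU1 /col' /rk' => /orP [/eqP -> | yY].
      rewrite eqxx => /sw /exists_inP [b bBY /eqP ->]; exists b; split=> //.
        by move: bBY; rewrite !inE => /orP [-> | ->]; rewrite ?orbT.
      rewrite in_setU1 => /orP [/eqP bx | bY].
        by move: bBY; rewrite bx inE (negPf xB) (negPf xY).
      by rewrite neqx // ltnS leq_bigmax.
    rewrite neqx // => /(dr _ _ yY) [b [bBY -> h]]; exists b; split=> //.
      by move: bBY; rewrite !inE => /orP [-> | ->]; rewrite ?orbT.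
    rewrite in_setU1 => /orP [/eqP bx | bY]; last by rewrite neqx ?h.
    by move: bBY; rewrite bx inE (negPf xB) (negPf xY).
apply: (IHm _ _ _ _ dr'); apply: leq_trans sz; apply: proper_card.
apply/properP; split; first by rewrite setDS ?setUS ?subsetUr.
by exists x; rewrite // !inE eqxx orbT.
Qed.

(** However many vertices are absorbed, the new diameter is paid for by the weight of the new
    colors, up to [2 * r]. *)
Lemma cluster_saturate : exists B' U' t',
  [/\ cluster E W K B' U' t', saturated E W K B' U', B \subset B', U \subset U'
    & r * t' + weight r E U <= r * t + weight r E U' + 2 * r].
Proof.
have [c0 _ | none] := pickP C; last first.
  exists B, U, t; split=> // [c | ]; last by clear; lia.
  by have := none c.
have [Y [col [rk [drY sat]]]] := draining_saturated c0.
have [t' clB' t'b] := drain_cluster drY.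
exists (B :|: Y), (U :|: col @: Y), t'; split; rewrite ?subsetUl //.
rewrite weightU; first by move: t'b; clear; lia.
case: drY => _ _ colKU _; rewrite -setI_eq0; apply/eqP/setP => c; rewrite !inE.
apply/negP => /andP [cU /imsetP [y yY cy]].
by have := colKU _ yY; rewrite -cy inE cU.
Qed.

End Saturation.

(** * Contracting clusters *)

Lemma eq_set2 (T : finType) (a b x y : T) :
  [set a; b] = [set x; y] -> a = x /\ b = y \/ a = y /\ b = x.
Proof.
move=> e; have /set2P ha : a \in [set x; y] by rewrite -e set21.
have /set2P hb : b \in [set x; y] by rewrite -e set22.
have /set2P hx : x \in [set a; b] by rewrite e set21.
have /set2P hy : y \in [set a; b] by rewrite e set22.
by case: ha; case: hb; case: hx; case: hy; intuition congruence.
Qed.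

Definition singles (V C : finType) (E : C -> {set {set V}}) (K : {set C}) :=
  [set c in K | #|E c| == 1].

Section Contraction.
Variables (V C : finType) (r : nat).
Variables (E : C -> {set {set V}}) (W : {set V}) (K : {set C}).
Hypothesis EWK : classes r E W K.
Variables (B : {set V}) (U : {set C}) (t : nat) (b0 : V).
Hypothesis clB : cluster E W K B U t.
Hypothesis b0B : b0 \in B.
Hypothesis nocyc : ~ rcyc E K t.+1.

Let proj x := if x \in B then b0 else x.
Definition contract c : {set {set V}} := [set proj @: e | e : {set V} in E c].
Let W' := b0 |: (W :\: B).
Let K' := K :\: U.

Let proj2 x y : proj @: [set x; y] = [set proj x; proj y].
Proof. by rewrite imsetU1 imset_set1. Qed.

Let pair c e : c \in K -> e \in E c ->
  exists x y, [/\ e = [set x; y], x != y, x \in W & y \in W].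
Proof.
move=> cK eE; have [x xe] : exists x, x \in e.
  by apply/set0Pn; rewrite -card_gt0; case: EWK => /(_ _ _ cK eE) ->.
have [y [-> yx xW yW]] := edge_pair EWK cK eE xe.
by exists x, y; rewrite eq_sym.
Qed.

Let outside c x y : c \in K' -> [set x; y] \in E c -> ~~ ((x \in B) && (y \in B)).
Proof.
move=> cK' eE; apply: contraL eE => /andP [xB yB].
exact: (no_inner_edge clB nocyc cK' xB yB).
Qed.

Let projW x : x \in W -> proj x \in W'.
Proof. by move=> xW; rewrite /proj !inE; case: ifP => xB; rewrite ?eqxx ?xB ?xW ?orbT. Qed.

Let proj_fix x z : proj z = x -> x \notin B -> z = x.
Proof. by rewrite /proj; case: ifP => // _ <-; rewrite b0B. Qed.

Let contract_edge c x y : c \in K' -> [set x; y] \in contract c ->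
  exists p q, [/\ [set p; q] \in E c, proj p = x & proj q = y].
Proof.
move=> /setDP [cK _] /imsetP [e eE].
have [p [q [ee _ _ _]]] := pair cK eE; subst e; rewrite proj2.
case/eq_set2 => [[-> ->] | [-> ->]]; first by exists p, q.
by exists q, p; rewrite setUC.
Qed.

(** No loop arises, because by [no_inner_edge] a color outside [U] has no edge inside [B]. *)
Lemma contract_classes : classes r contract W' K'.
Proof.
split=> [c e /[dup] cK' /setDP [cK _] /imsetP [f fE ->] |
         c e /[dup] cK' /setDP [cK _] /imsetP [f fE ->] | c /setDP [cK _]].
- have [x [y [fe xy _ _]]] := pair cK fE; subst f; rewrite proj2 cards2.
  suff -> : proj x != proj y by [].
  have := outside cK' fE; rewrite /proj.
  case: ifP => xB; case: ifP => yB //= _.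
    by apply: contraFneq yB => <-.
  by apply: contraFneq xB => ->.
- have [x [y [-> _ xW yW]]] := pair cK fE.
  by rewrite proj2 subUset !sub1set !projW.
case: EWK => _ _ /(_ _ cK) /andP [E0 Er]; apply/andP; split.
  have /set0Pn [e eE] : E c != set0 by rewrite -card_gt0.
  by rewrite card_gt0; apply/set0Pn; exists (proj @: e); apply: imset_f.
exact: leq_trans (leq_imset_card _ _) Er.
Qed.

Lemma contract_excess : #|W'| + #|K| = #|W| + #|K'|.
Proof.
case: clB => BW UK cB _.
rewrite cardsU1 !inE b0B /= !cardsDS // cB add1n.
have := subset_leq_card BW; have := subset_leq_card UK; rewrite cB.
by clear; lia.
Qed.

Lemma contract_lt : 1 < #|B| -> #|W'| < #|W|.
Proof.
case: clB => BW _ _ _ B1; rewrite cardsU1 !inE b0B /= cardsDS //.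
by have := subset_leq_card BW; move: B1; clear; lia.
Qed.

(** Only leaving classes can lose edges. Each remains nonempty, so its weight rises from at least 1
    to at most [r]. *)
Lemma contract_weight :
  weight r contract K' + weight r E U <= weight r E K + r.-1 * #|leaving E K B U|.
Proof.
case: clB => _ UK _ _; set L := leaving E K B U.
have -> : weight r E K = weight r E U + weight r E K'.
  by rewrite /weight (big_setID U) /= (setIidPr UK).
rewrite addnC -addnA leq_add2l /weight.
have LK : L \subset K' by apply/subsetP => c; rewrite inE => /andP [].
rewrite (big_setID L) [X in _ <= X + _](big_setID L) /= (setIidPr LK).
have -> : \sum_(c in K' :\: L) (r.+1 - #|contract c|) =
    \sum_(c in K' :\: L) (r.+1 - #|E c|).
  apply: eq_bigr => c /setDP [cK' cL]; congr (_ - #|pred_of_set _|).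
  have fix_e e : e \in E c -> proj @: e = e.
    move=> eE; rewrite -[RHS]imset_id; apply: eq_in_imset => x xe.
    rewrite /proj; case: ifP => // xB; case/negP: cL; rewrite inE cK' /=.
    apply/existsP; exists e; rewrite eE; apply/set0Pn; exists x.
    by rewrite inE xe xB.
  by rewrite /contract -[RHS]imset_id; apply: eq_in_imset.
rewrite addnAC leq_add2r mulnC -sum_nat_const -big_split /=.
apply: leq_sum => c /(subsetP LK) /[dup] cK' /setDP [cK _].
case: EWK => _ _ /(_ _ cK) /andP [_ Er].
case: contract_classes => _ _ /(_ _ cK') /andP [E0 _].
by move: #|E c| #|contract c| Er E0 => m n; clear; lia.
Qed.

(** If a class shrinks to one edge touching [b0], all its edges join one outside vertex to [B],
    which saturation forbids. A class away from [B] is unchanged. *)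
Lemma contract_singles : saturated E W K B U ->
  singles contract K' \subset singles E K :\: U.
Proof.
move=> sat; apply/subsetP => c; rewrite !inE => /andP [/andP [cU cK]].
move=> /cards1P [f fE]; rewrite cU cK /=.
have cK' : c \in K' by rewrite inE cU.
have all_f e : e \in E c -> proj @: e = f.
  by move=> eE; apply/set1P; rewrite -fE; apply: imset_f.
have [/existsP [e /andP [eE]] | ] :=
  boolP [exists e in E c, e :&: B != set0]; last first.
  move/exists_inPn => none.
  have fix_e e : e \in E c -> e = f.
    move=> eE; rewrite -(all_f _ eE) -[LHS]imset_id; apply: eq_in_imset => x xe.
    rewrite /proj; case: ifP => // xB; case/negP: (none _ eE).
    by apply/set0Pn; exists x; rewrite inE xe xB.
  rewrite -(cards1 f); apply/eqP; congr (#|pred_of_set _|); apply/setP => e.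
  rewrite inE; apply/idP/eqP => [/fix_e // | ->].
  have /set0Pn [e' /[dup] e'E /fix_e <- //] : E c != set0.
  by rewrite -card_gt0; case: EWK => _ _ /(_ _ cK) /andP [].
case/set0Pn => b /setIP [be bB].
have [x [ee xb bW xW]] := edge_pair EWK cK eE be.
have xB : x \notin B.
  by have := @outside c b x cK'; rewrite -ee bB => /(_ eE).
have fx : f = [set b0; x].
  by rewrite -(all_f _ eE) ee proj2 /proj bB (negPf xB).
have xWB : x \in W :\: B by rewrite inE xB.
case/negP: (sat _ _ cK' xWB).
apply/forall_inP => e' e'E; have [p [q [e'e _ _ _]]] := pair cK e'E.
have := all_f _ e'E; rewrite fx e'e proj2.
have inB z : proj z = b0 -> z \in B.
  by rewrite /proj; case: ifP => // zB zb; rewrite zb b0B in zB.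
case/eq_set2 => [[pb qx] | [px qb]].
  apply/exists_inP; exists p; first exact: inB.
  by rewrite (proj_fix qx xB) setUC.
apply/exists_inP; exists q; first exact: inB.
by rewrite (proj_fix px xB).
Qed.

Let contract_cwalk (K1 : {set C}) a s : K1 \subset K' -> all (mem K1) (unzip1 s) ->
  a \notin B -> all (fun x => x \notin B) (unzip2 s) ->
  cwalk contract a s -> cwalk E a s.
Proof.
move=> sub; elim: s a => [|[c x] s IHs] a //= /andP [cK1 sK] aB /andP [xB sB].
case/andP => ax xs; rewrite IHs // andbT.
have [p [q [pq pa qx]]] := contract_edge (subsetP sub _ cK1) ax.
by rewrite -(proj_fix pa aB) -(proj_fix qx xB).
Qed.

Let contract_vertices (K1 : {set C}) a s : K1 \subset K' -> all (mem K1) (unzip1 s) ->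
  cwalk contract a s -> all (mem W') (unzip2 s).
Proof.
move=> sub; elim: s a => [|[c x] s IHs] a //= /andP [cK1 sK] /andP [ax xs].
rewrite (IHs x) // andbT; case: contract_classes => _ EW _.
by apply: (subsetP (EW _ _ (subsetP sub _ cK1) ax)); rewrite !inE eqxx orbT.
Qed.

(** A vertex-simple cycle passes [b0] at most once. There its two edges lift to edges ending in [B],
    and these ends are joined inside the cluster by colors of [U], which the cycle does not use. *)
Lemma contract_rcyc l : rcyc contract K' l -> rcyc E K (l + t).
Proof.
case/rcyc_simple => u [s [/and4P [sw /eqP sl su sK] s0 ssz us]].
have sW := contract_vertices (subxx _) sK sw.
have notB x : x \in W' -> x != b0 -> x \notin B.
  by rewrite !inE => /orP [-> // | /andP []].
have [b0s | b0s] := boolP (b0 \in unzip2 s); last first.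
  have sB : all (fun x => x \notin B) (unzip2 s).
    apply/allP => x xs; apply: notB; first exact: (allP sW).
    by apply: contraNneq b0s => <-.
  have uB : u \notin B.
    apply: (allP sB); rewrite -sl; case: (s) s0 => // p s' _ /=; exact: mem_last.
  exists u, s; split=> //; last exact: leq_trans ssz (leq_addr _ _).
  apply: (rwalk_sub (subsetDl K U)); apply/and4P; split=> //; last by rewrite sl.
  exact: contract_cwalk (subxx _) sK uB sB sw.
case/mapP: b0s => -[c z] ps /= zb; subst z.
case/splitPr: ps => s1 s2 in sw sl su sK s0 ssz us sW *.
have eqs2 : perm_eq (s2 ++ rcons s1 (c, b0)) (s1 ++ (c, b0) :: s2).
  by rewrite perm_catC cat_rcons.
(* After rotation the cycle starts and ends at [b0], and [q] holds the steps before the last one. *)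
set q := s2 ++ s1.
have qE : s2 ++ rcons s1 (c, b0) = rcons q (c, b0) by rewrite rcons_cat.
have qw : cwalk contract b0 (rcons q (c, b0)).
  have lb : last b0 (unzip2 s2) = u.
    by move: sl; rewrite /unzip2 map_cat last_cat.
  have lr : last u (unzip2 (rcons s1 (c, b0))) = b0.
    by rewrite /unzip2 map_rcons last_rcons.
  move: sw; rewrite -qE -cat_rcons !cwalk_cat lb lr => /andP [w1 w2].
  by rewrite w1 w2.
have qu : uniq (unzip1 (rcons q (c, b0))).
  by rewrite -qE (perm_uniq (perm_map _ eqs2)).
have qK : all (mem K') (unzip1 (rcons q (c, b0))).
  by rewrite -qE (perm_all _ (perm_map _ eqs2)).
have qW : all (mem W') (unzip2 (rcons q (c, b0))).
  by rewrite -qE (perm_all _ (perm_map _ eqs2)).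
have qb : b0 \notin unzip2 q.
  have : uniq (unzip2 (rcons q (c, b0))).
    by rewrite -qE (perm_uniq (perm_map _ eqs2)).
  by rewrite /unzip2 map_rcons rcons_uniq => /andP [].
have qsz : size q < l.
  by move: ssz; rewrite -(perm_size eqs2) qE size_rcons.
(* An empty [q] would mean a loop at [b0]. *)
move: qw qu qK qW qb qsz; move: q {qE eqs2} => [|[d x] q].
  rewrite /= andbT => e _ /andP [cK' _] _ _ _.
  by have := edge_neq contract_classes cK' e; rewrite eqxx.
rewrite /= in_cons negb_or => /andP [e1 qw] qu /andP [dK' qK] /andP [xW' qW].
case/andP => xb0 qb qsz.
have xB : x \notin B by apply: notB => //; rewrite eq_sym.
move: qw qK qW; rewrite -cats1 cwalk_cat /= andbT /unzip1 /unzip2 !map_cat !all_cat /=.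
rewrite -!/(unzip1 _) -!/(unzip2 _) !andbT.
case/andP => qw e2 /andP [qK cK'] /andP [qW _].
have qB : all (fun y => y \notin B) (unzip2 q).
  apply/allP => y yq; apply: notB; first exact: (allP qW).
  by apply: contraNneq qb => <-.
have [b [x' [bx bb xx]]] := contract_edge dK' e1.
rewrite (proj_fix xx xB) in bx.
have [y' [b' [yb yy bb']]] := contract_edge cK' e2.
have yB : last x (unzip2 q) \notin B.
  case: (unzip2 q) qB xB => [//|z s'] /allP zB _.
  exact: (zB (last z s') (mem_last z s')).
rewrite (proj_fix yy yB) in yb.
have inB z : z \in W -> proj z = b0 -> z \in B.
  by move=> _; rewrite /proj; case: ifP => // zB zb; rewrite zb b0B in zB.
have wB (f : C) (z z' : V) : f \in K' -> [set z; z'] \in E f -> z \in W /\ z' \in W.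
  move=> /setDP [fK _] h; case: EWK => _ /(_ _ _ fK h) + _.
  by rewrite subUset !sub1set => /andP.
have bB : b \in B by apply: inB bb; case: (wB _ _ _ dK' bx).
have b'B : b' \in B by apply: inB bb'; case: (wB _ _ _ cK' yb).
case: clB => _ UK _ conn; have [s3 s3w s3sz] := conn _ _ b'B bB.
have w1 : rwalk E K' b (((d, x) :: q) ++ [:: (c, b')]) b'.
  apply/and4P; split.
  - by rewrite cwalk_cat /= bx yb (contract_cwalk (subxx _) qK xB qB qw).
  - by rewrite /unzip2 map_cat last_cat.
  - by move: qu; rewrite /unzip1 /= map_cat map_rcons /= cats1.
  - by rewrite /unzip1 map_cat all_cat /= qK dK' cK'.
have dis : [disjoint K' & U] by rewrite disjoints_subset /K' setDE subsetIr.
exists b, ((((d, x) :: q) ++ [:: (c, b')]) ++ s3); split.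
- apply: rwalk_sub (rwalk_cat dis w1 s3w).
  by rewrite subUset subsetDl.
- by [].
- rewrite !size_cat leq_add // addn1; exact: qsz.
Qed.

End Contraction.

(** * Clusters in a minimal counterexample *)

Definition short (V C : finType) r (E : C -> {set {set V}}) K A :=
  exists2 l, rcyc E K l & r * l <= weight r E K + A.

Section Surplus.
Variables (V C : finType) (r k j A : nat).
Variables (E : C -> {set {set V}}) (W : {set V}) (K : {set C}).
Hypothesis r2 : 1 < r.
Hypothesis A4 : 4 * r <= A.
Hypothesis EWK : classes r E W K.
Hypothesis excess : #|W| + k <= #|K|.

Lemma short_contract A' B U t : ~ rcyc E K t.+1 ->
  cluster E W K B U t -> saturated E W K B U -> 1 < #|B| ->
  (forall (E' : C -> {set {set V}}) (W' : {set V}) (K' : {set C}),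
    classes r E' W' K' -> W' != set0 -> #|W'| + k <= #|K'| ->
    singles E' K' \subset singles E K :\: U -> #|W'| < #|W| -> short r E' K' A') ->
  exists2 l, rcyc E K l & r * l + weight r E U <=
    weight r E K + A' + r * t + r.-1 * #|leaving E K B U|.
Proof.
move=> nocyc clB sat B1 IH; have /set0Pn [b0 b0B] : B != set0.
  by rewrite -card_gt0 ltnW.
have [||||| l lc lb] := IH (contract E B b0) (b0 |: W :\: B) (K :\: U).
- exact (contract_classes EWK clB b0B nocyc).
- by apply/set0Pn; exists b0; rewrite !inE eqxx.
- have := contract_excess clB b0B; move: excess; clear; lia.
- exact (contract_singles EWK clB b0B nocyc sat).
- exact (contract_lt clB b0B B1).
exists (l + t); first exact (contract_rcyc EWK clB b0B nocyc lc).
have := contract_weight EWK clB b0B nocyc; rewrite mulnDr; move: lb; clear; lia.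
Qed.

Hypothesis long : ~ short r E K A.
Hypothesis IH : forall (E' : C -> {set {set V}}) (W' : {set V}) (K' : {set C}),
  classes r E' W' K' -> W' != set0 -> #|W'| + k <= #|K'| ->
  #|singles E' K'| <= #|singles E K| -> #|W'| < #|W| -> short r E' K' A.

Lemma no_rcyc l : r * l <= weight r E K + A -> ~ rcyc E K l.
Proof. by move=> lb lc; apply: long; exists l. Qed.

Lemma no_rcyc_cluster B U t : cluster E W K B U t ->
  r * t <= weight r E U + 2 * r -> ~ rcyc E K t.+2.
Proof.
case=> _ UK _ _ tb; apply: no_rcyc; rewrite !mulnS.
have := weight_sub r E UK; move: tb A4; clear; lia.
Qed.

(** Growth lengthens walks by two steps, costing [2 * r], and saturation costs [2 * r] more; in
    return every leaving color brings weight at least 1. *)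
Lemma grow_saturate B U t : cluster E W K B U t ->
  r * t <= weight r E U + 2 * r -> exists B' U' t',
  [/\ cluster E W K B' U' t', saturated E W K B' U',
      #|B| + #|leaving E K B U| <= #|B'|
    & r * t' + weight r E U + #|leaving E K B U| <=
      r * t + weight r E U' + 4 * r].
Proof.
move=> clB tb; have nocyc := no_rcyc_cluster clB tb.
have [B1 [U1 [clB1 BB1 U1E cB1]]] := cluster_grow EWK clB nocyc.
have r0 : 0 < r by exact: ltnW.
have [B2 [U2 [t2 [clB2 sat B12 U12 t2b]]]] := cluster_saturate r0 EWK clB1.
exists B2, U2, t2; split=> //; first by rewrite -cB1 subset_leq_card.
have LK : leaving E K B U \subset K.
  by apply/subsetP => c; rewrite inE => /andP [/setDP []].
have wU1 : weight r E U1 = weight r E U + weight r E (leaving E K B U).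
  rewrite U1E weightU // -setI_eq0; apply/eqP/setP => c; rewrite !inE.
  by case: (c \in U).
have := weight_card EWK LK; move: t2b; rewrite wU1 !mulnS; clear; lia.
Qed.

(** Contracting a cluster with a surplus gives a short cycle unless more than [4 * r] colors leave
    it. But then growing and saturating enlarges the cluster without lowering its surplus, which
    cannot go on forever. *)
Lemma no_surplus B U t : cluster E W K B U t -> saturated E W K B U -> 1 < #|B| ->
  weight r E U < r * t + 4 * r ^ 2.
Proof.
have [m] := ubnP (#|W| - #|B|); elim: m B U t => // m IHm B U t; rewrite ltnS => sz.
move=> clB sat B1; rewrite ltnNge; apply/negP => surplus.
have tb : r * t <= weight r E U + 2 * r by move: surplus; clear; lia.
have nocyc := no_rcyc_cluster clB tb.
have nocyc1 : ~ rcyc E K t.+1 by move=> h; apply: nocyc; apply: rcyc_sub h.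
have [|l lc lb] := short_contract (A' := A) nocyc1 clB sat B1.
  move=> E' W' K' cl W0 ex sing lt; refine (IH cl W0 ex _ lt).
  exact: subset_leq_card (subset_trans sing (subsetDl _ _)).
have loss : weight r E U < r * t + r.-1 * #|leaving E K B U|.
  rewrite ltnNge; apply/negP => h; apply: long; exists l => //.
  by move: lb h; clear; lia.
have L4 : 4 * r < #|leaving E K B U|.
  rewrite ltnNge; apply/negP => h; have := leq_mul (leqnn r.-1) h.
  have : r.-1 * (4 * r) <= 4 * r ^ 2.
    by rewrite mulnCA leq_mul2l -mulnn leq_mul2r leq_pred orbT.
  by move: loss surplus; clear; lia.
have [B' [U' [t' [clB' sat' cB' t'b]]]] := grow_saturate clB tb.
have B'W : #|B'| <= #|W| by case: clB' => /subset_leq_card.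
have : weight r E U' < r * t' + 4 * r ^ 2.
  by apply: IHm clB' sat' _; move: sz B1 cB' L4 B'W; clear; lia.
by move: t'b surplus L4; clear; lia.
Qed.

(** With too many leaving colors, growing and saturating would produce the surplus excluded by
    [no_surplus]. The slack [o] is what the cluster already owes. *)
Lemma few_leaving B U t o : o <= 2 * r -> cluster E W K B U t ->
  0 < #|B| -> r * t <= weight r E U + o ->
  #|leaving E K B U| < 4 * r ^ 2 + 4 * r + o.
Proof.
move=> o2 clB B0 tb; rewrite ltnNge; apply/negP => many.
have [|B' [U' [t' [clB' sat' cB' t'b]]]] := grow_saturate clB.
  by move: tb o2; clear; lia.
have B'1 : 1 < #|B'|.
  apply: leq_trans cB'; have : 0 < 4 * r by rewrite muln_gt0 /= ltnW.
  by move: B0 many; clear; lia.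
by have := no_surplus clB' sat' B'1; move: t'b tb many; clear; lia.
Qed.

End Surplus.

(** * Color excess forces short cycles *)

(** The first two terms of the binomial expansion suffice. *)
Lemma double_expn n k q : 0 < n -> n <= q * k -> 2 * n ^ q <= (n + k) ^ q.
Proof.
case: q => [|q] n0 h; first by move: n0; rewrite mul0n in h; move: h; clear; lia.
rewrite expnDn (bigD1 ord0) //= (bigD1 (lift ord0 ord0)) //= addnA mul2n -addnn.
apply: leq_trans (leq_addr _ _); rewrite bin0 bin1 subn0 muln1 mul1n expn1 /bump /= subn1 /=.
by rewrite leq_add2l expnS [q.+1 * _]mulnCA mulnC leq_mul2l h orbT.
Qed.

Section Sparse.
Variables (V C : finType) (n k m : nat).
Variables (E : C -> {set {set V}}) (W : {set V}) (K : {set C}).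
Hypothesis n0 : 0 < n.
Hypothesis k0 : 0 < k.
Hypothesis Wn : #|W| <= n.
Hypothesis EWK : classes 1 E W K.
Hypothesis touch : forall B : {set V}, B != set0 -> B \subset W ->
  (n + k) * #|B| <= n * #|[set c in K | [exists e in E c, e :&: B != set0]]|.

(** By [touch], the next ball has at least [(1 + k / n) * #|B| + 1] vertices. The quantity
    [k * #|B| + n] turns this affine recurrence into growth by the factor [(n + k) / n]. *)
Lemma expand v i : v \in W -> ~ rcyc E K i.*2 -> exists B U,
  cluster E W K B U i.*2 /\ (n + k) ^ i.+1 <= n ^ i * (k * #|B| + n).
Proof.
move=> vW; elim: i => [_ | i IHi nocyc].
  exists [set v], set0; split; first exact: cluster1.
  by rewrite cards1 expn1 expn0 mul1n muln1 addnC.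
have [|B [U [clB lb]]] := IHi; first by move=> h; apply: nocyc; apply: rcyc_sub h; rewrite // doubleS !leqW.
have [B' [U' [clB' BB' U'E cB']]] := cluster_grow EWK clB nocyc.
exists B', U'; split=> //.
have [_ _ cB'U _] := clB'; have [BW UK cBU _] := clB.
have := touch _ BW; rewrite -card_gt0 cBU => /(_ isT).
have sub : [set c in K | [exists e in E c, e :&: B != set0]] \subset U'.
  apply/subsetP => c; rewrite U'E !inE => /andP [-> ->].
  by case: (c \in U).
move=> /leq_trans /(_ (leq_mul (leqnn n) (subset_leq_card sub))).
rewrite -cBU cB'U mulnS => grow.
have step : (n + k) * (k * #|B| + n) <= n * (k * #|U'| + (k + n)).
  have := leq_mul (leqnn k) grow; rewrite !mulnDl !mulnDr.
  rewrite ![k * (n * _)]mulnCA ![k * n]mulnC ![n * (k * _)]mulnCA; clear; lia.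
rewrite expnS; apply: leq_trans (leq_mul (leqnn (n + k)) lb) _.
by rewrite mulnCA expnSr -mulnA leq_mul2l [k + _]addnC -addnA step orbT.
Qed.

(** Every [q] rounds double the growth factor. After [m * q] rounds without a cycle, the factor
    [2 ^ m > k] would give the ball more than [n] vertices. *)
Lemma expand_cycle v : v \in W -> k < 2 ^ m ->
  exists2 l, rcyc E K l & l <= (m * (n %/ k).+1).*2.
Proof.
move=> vW km; apply: contrapT => nocyc.
set q := (n %/ k).+1 in nocyc.
have [|B [U [clB]]] := expand (i := m * q) vW; first by move=> h; apply: nocyc; exists (m * q).*2.
apply/negP; rewrite -ltnNge.
have nq : 2 ^ m * n ^ (m * q) <= (n + k) ^ (m * q).
  rewrite [m * q]mulnC !expnM -expnMn leq_exp2r.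
    by apply: double_expn => //; rewrite ltnW // ltn_ceil.
  by case: (posnP m) km => // ->; rewrite ltnNge k0.
have Bn : #|B| <= n by case: clB => /subset_leq_card /leq_trans /(_ Wn).
have n0q : 0 < n ^ (m * q) by rewrite expn_gt0 n0.
apply: (@leq_trans (2 ^ m * n ^ (m * q) * (n + k))); last by rewrite expnSr leq_mul2r nq orbT.
rewrite mulnAC mulnC ltn_pmul2r //.
apply: leq_ltn_trans (_ : k.+1 * n < _).
  by rewrite mulSn addnC leq_add2l leq_mul2l Bn orbT.
by apply: leq_ltn_trans (leq_mul km (leqnn n)) _; rewrite ltn_pmul2l ?expn_gt0 // -addn1 leq_add2l.
Qed.

End Sparse.

Definition inner (V C : finType) (E : C -> {set {set V}}) (K : {set C}) (X : {set V}) :=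
  [set c in K | [forall e in E c, e \subset X]].

(** In an inclusion-minimal set [X] of density at least [1 + k / #|W|], removing any [B] must
    destroy proportionally many edges, which is the expansion hypothesis [touch]. *)
Lemma sparse_cycle (V C : finType) (k m : nat) (E : C -> {set {set V}})
    (W : {set V}) (K : {set C}) :
  classes 1 E W K -> W != set0 -> 0 < k < 2 ^ m -> #|W| + k <= #|K| ->
  exists2 l, rcyc E K l & l <= (m * (#|W| %/ k).+1).*2.
Proof.
move=> EWK W0 /andP [k0 km] ex; have n0 : 0 < #|W| by rewrite card_gt0.
set n := #|W| in ex n0 *.
pose P (X : {set V}) := [&& X \subset W, X != set0 & (n + k) * #|X| <= n * #|inner E K X|].
have PW : P W.
  rewrite /P subxx W0 /= mulnC leq_mul2l; apply/orP; right; apply: leq_trans ex _.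
  apply: subset_leq_card; apply/subsetP => c cK; rewrite inE cK /=.
  by apply/forall_inP => e; case: EWK => _ EW _; exact: EW.
have [X /minsetP [/and3P [_ X0 Xd] Xmin] XW] := minset_exists PW.
have /set0Pn [v vX] := X0.
have KX : inner E K X \subset K by apply/subsetP => c; rewrite inE => /andP [].
have cl : classes 1 E X (inner E K X).
  case: EWK => E2 EW E1; split=> [c e|c e|c]; rewrite inE => /andP [cK /forall_inP h].
  - exact: E2.
  - exact: h.
  - exact: E1.
have [| l lc lb] := expand_cycle (n := n) n0 k0 (subset_leq_card XW) cl _ vX km.
  move=> B B0 BX.
  set T := [set c in _ | _].
  have split : inner E K X \subset T :|: inner E K (X :\: B).
    apply/subsetP => c cX; rewrite !inE.
    move: (cX); rewrite inE => /andP [cK cXX]; have /forall_inP h := cXX; rewrite cK cXX /=.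
    case: (boolP [exists e in E c, _]) => //= no.
    apply/forall_inP => e eE; rewrite subsetD h //=.
    rewrite -setI_eq0; apply: contraNT no => eB; apply/existsP; exists e.
    by rewrite eE.
  have := leq_trans (subset_leq_card split) (leq_card_setU _ _) => tot.
  have : n * #|inner E K (X :\: B)| <= (n + k) * #|X :\: B|.
    have [-> | XB0] := eqVneq (X :\: B) set0.
      rewrite [inner _ _ _](_ : _ = set0) ?cards0 ?muln0 //.
      apply/setP => c; rewrite !inE; apply/negP => /andP [cK /forall_inP h].
      case: EWK => E2 _ /(_ _ cK) /andP [] + _; rewrite card_gt0.
      case/set0Pn => e eE; have := h _ eE; rewrite subset0 => /eqP e0.
      by have := E2 _ _ cK eE; rewrite e0 cards0.
    rewrite leqNgt; apply/negP => /ltnW dense.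
    have := Xmin (X :\: B); rewrite /P XB0 dense (subset_trans (subsetDl _ _) XW).
    move=> /(_ isT (subsetDl _ _)) /setP XB; have /set0Pn [b bB] := B0.
    by have := XB b; rewrite !inE bB (subsetP BX).
  have := leq_mul (leqnn n) tot.
  have cX : #|X| = #|B| + #|X :\: B|.
    by rewrite -(cardsID B X) (setIidPr BX).
  by move: Xd; rewrite cX !mulnDr; clear; lia.
by exists l => //; apply: rcyc_sub lc.
Qed.

(** Keep one edge per color. For the excess [k = 2 * r * m], the cycle of [sparse_cycle] satisfies
    [r * l <= #|W| + k <= #|K|], and every color weighs at least 1. *)
Lemma short_of_excess (V C : finType) (r m : nat) (E : C -> {set {set V}})
    (W : {set V}) (K : {set C}) :
  classes r E W K -> W != set0 -> 0 < r -> 0 < m -> (r * m).*2 < 2 ^ m ->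
  #|W| + (r * m).*2 <= #|K| -> short r E K 0.
Proof.
move=> EWK W0 r0 m0 rm ex.
pose E1 c := if [pick e in E c] is Some e then [set e] else set0.
have E1E c : c \in K -> exists2 e, e \in E c & E1 c = [set e].
  move=> cK; rewrite /E1; case: pickP => [e eE | none]; first by exists e.
  case: EWK => _ _ /(_ _ cK) /andP [+ _]; rewrite card_gt0 => /set0Pn [e].
  by have := none e; rewrite /= => ->.
have cl : classes 1 E1 W K.
  case: EWK => E2 EW _; split=> [c e|c e|c] cK; have [e' e'E ->] := E1E _ cK.
  - by move/set1P ->; exact: E2 e'E.
  - by move/set1P ->; exact: EW e'E.
  - by rewrite cards1.
have k0 : 0 < (r * m).*2 by rewrite double_gt0 muln_gt0 r0.
have [|l [u [s [w s0 sl]]] lb] := sparse_cycle (k := (r * m).*2) (m := m) cl W0 _ ex.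
  by rewrite k0.
exists l.
  apply: (rcyc_mono (E := E1)); last by exists u, s.
  by move=> c cK; have [e eE ->] := E1E _ cK; rewrite sub1set.
rewrite addn0; apply: leq_trans (weight_card EWK (subxx K)).
apply: leq_trans ex; apply: leq_trans (leq_mul (leqnn r) lb) _.
rewrite -muln2 !mulnA -[r * m * _ * 2]mulnAC muln2 mulnS addnC leq_add2r.
by rewrite mulnC leq_trunc_div.
Qed.

(** * The induction *)

Definition covers (V C : finType) (E : C -> {set {set V}}) z c :=
  [forall e in E c, z \in e].

Lemma short_leq (V C : finType) r (E : C -> {set {set V}}) K A A' :
  A <= A' -> short r E K A -> short r E K A'.
Proof.
by move=> AA [l lc lb]; exists l => //; apply: leq_trans lb _; rewrite leq_add2l.
Qed.

(** A directed cycle is extracted from the closed walk; its tails are distinct, hence so are its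
    colors. *)
Lemma rcyc_of_dclosed (V C : finType) (E : C -> {set {set V}}) (W : {set V})
    (K : {set C}) (col : V -> C) (N : V -> {set V}) k :
  {in W &, injective col} -> (forall v, v \in W -> col v \in K) ->
  (forall v, v \in W -> N v \subset W) ->
  (forall v x, v \in W -> x \in N v -> [set v; x] \in E (col v)) ->
  dclosed N W k -> rcyc E K k.
Proof.
move=> inj colK NW NE /andP [k0 /existsP [u /andP [uW uu]]].
pose e := [rel x y | y \in N x].
have path_of i x y : dwalk N i x y ->
    exists s, [/\ path e x s, last x s = y & size s = i].
  elim: i x => [|i IHi] x /=; first by move/eqP ->; exists [::].
  case/existsP => z /andP [xz /IHi [s [zs sl sz]]]; exists (z :: s).
  by rewrite /= xz zs sl sz.
have [[|x s] [ps sl sz]] := path_of _ _ _ uu; first by rewrite -sz in k0.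
case/andP: ps => ux xs; rewrite /= in sl; have sk : size s < k by rewrite -sz.
case/shortenP: xs sl => s' xs' us' sub sl.
have s'k : size s' < k.
  by apply: leq_ltn_trans sk; apply: uniq_leq_size => //; case/andP: us'.
have pW y t : y \in W -> path e y t -> all (mem W) t.
  elim: t y => //= z t IHt y yW /andP [yz zt].
  have zW := subsetP (NW _ yW) _ yz.
  by rewrite zW (IHt _ zW).
have xW := subsetP (NW _ uW) _ ux; have s'W := pW _ _ xW xs'.
have col_walk y t : y \in W -> path e y t ->
    cwalk E y (pairmap (fun a b => (col a, b)) y t).
  elim: t y => //= z t IHt y yW /andP [yz zt].
  by rewrite NE // IHt // (subsetP (NW _ yW)).
have un2 y t : unzip2 (pairmap (fun a b => (col a, b)) y t) = t.
  by elim: t y => //= z t IHt y; rewrite IHt.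
have un1 y t : unzip1 (pairmap (fun a b => (col a, b)) y t) = map col (belast y t).
  by elim: t y => //= z t IHt y; rewrite IHt.
exists u, (pairmap (fun a b => (col a, b)) u (x :: s')); split.
- apply/and4P; split.
  + by apply: col_walk => //; apply/andP.
  + by rewrite un2 /= sl.
  + rewrite un1 map_inj_in_uniq.
      by rewrite lastI sl rcons_uniq in us'.
    have bW : {subset belast u (x :: s') <= W}.
      move=> y /mem_belast; rewrite !inE => /or3P [/eqP -> | /eqP -> |] //.
      exact: (allP s'W).
    by move=> y z /bW yW /bW zW; exact: inj.
  + rewrite un1; apply/allP => _ /mapP [y /mem_belast yb ->]; apply: colK.
    move: yb; rewrite !inE => /or3P [/eqP -> | /eqP -> |] //.
    exact: (allP s'W).
- by [].
- by rewrite size_pairmap.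
Qed.

(** * The case where every vertex lies on all edges of some class *)

Section Covered.
Variables (V C : finType) (r : nat).
Variables (E : C -> {set {set V}}) (W : {set V}) (K : {set C}).
Hypothesis r2 : 1 < r.
Hypothesis EWK : classes r E W K.
Hypothesis W0 : W != set0.
Hypothesis E2 : forall c, c \in K -> 1 < #|E c|.

(** Orient a covered class away from its vertex. Two vertices cannot share a class, since only one
    edge contains both, so the total deficiency is bounded by the weight. *)
Lemma short_of_covers : (forall z, z \in W -> exists2 c, c \in K & covers E z c) ->
  short r E K (r * (2 * (r * r)) + 2 * r).
Proof.
move=> cov; have /set0Pn [z0 z0W] := W0; have [c0 _ _] := cov _ z0W.
pose col z := odflt c0 [pick c in K | covers E z c].
have colP z : z \in W -> col z \in K /\ covers E z (col z).
  move=> /cov [c cK zc]; rewrite /col; case: pickP => [d /andP [] // | /(_ c)].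
  by rewrite cK zc.
pose N z := [set y | [set z; y] \in E (col z)].
have NE v x : v \in W -> x \in N v -> [set v; x] \in E (col v) by rewrite inE.
have NW v : v \in W -> N v \subset W.
  move=> vW; apply/subsetP => y /(NE _ _ vW) vy; have [vK _] := colP _ vW.
  case: EWK => _ EW _; apply: (subsetP (EW _ _ vK vy)); exact: set22.
have cN v : v \in W -> #|E (col v)| <= #|N v|.
  move=> vW; have [vK /forall_inP vc] := colP _ vW.
  apply: leq_trans (leq_imset_card (fun y => [set v; y]) (N v)).
  apply: subset_leq_card; apply/subsetP => e eE.
  have [y [ey _ _ _]] := edge_pair EWK vK eE (vc _ eE).
  by apply/imsetP; exists y; rewrite // inE -ey.
have N0 v : v \in W -> N v != set0.
  move=> vW; rewrite -card_gt0; apply: leq_trans (cN _ vW).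
  by have [vK _] := colP _ vW; apply: ltnW; exact: E2.
have inj : {in W &, injective col}.
  move=> x y xW yW xy; apply/eqP; apply/negPn/negP => nxy.
  have [xK /forall_inP xc] := colP _ xW; have [_ /forall_inP yc] := colP _ yW.
  have := E2 xK; rewrite ltnNge; case/negP.
  rewrite -(cards1 [set x; y]); apply: subset_leq_card; apply/subsetP => e eE.
  rewrite inE eq_sym eqEcard subUset !sub1set xc //= yc -?xy //=.
  by case: EWK => e2 _ _; rewrite (e2 _ _ xK eE) cards2 nxy.
have [] := @girth_deficiency r (r * (2 * (r * r)) + 2 * r) r2 _ _ V W N W0 NW N0.
- rewrite (_ : 4 * r = 2 * r + 2 * r); last by clear; lia.
  by rewrite leq_add2r mulnC leq_mul2l leq_pmulr ?orbT // muln_gt0 ltnW.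
- by [].
move=> k kc kb; exists k.
  by apply: rcyc_of_dclosed kc; [exact: inj | move=> v /colP [] | | ].
apply: leq_trans kb _; rewrite leq_add2r.
have imK : col @: W \subset K by apply/subsetP => _ /imsetP [v /colP [vK _] ->].
apply: leq_trans (weight_sub r E imK); rewrite /weight big_imset //=.
apply: leq_sum => v vW; have [vK _] := colP _ vW; have := cN _ vW.
by case: EWK => _ _ /(_ _ vK) /andP [_]; move: #|_| #|_|; clear; lia.
Qed.

End Covered.

(** * Reductions of a minimal counterexample *)

Section Induction.
Variables (V C : finType) (r k A : nat).
Variables (E : C -> {set {set V}}) (W : {set V}) (K : {set C}).
Hypothesis r2 : 1 < r.
Hypothesis A4 : 4 * r <= A.
Hypothesis EWK : classes r E W K.
Hypothesis W0 : W != set0.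
Hypothesis excess : #|W| + k <= #|K|.
Hypothesis long : ~ short r E K A.
Hypothesis IH : forall (E' : C -> {set {set V}}) (W' : {set V}) (K' : {set C}),
  classes r E' W' K' -> W' != set0 -> #|W'| + k <= #|K'| ->
  #|singles E' K'| <= #|singles E K| -> #|W'| < #|W| -> short r E' K' A.

Let r0 : 0 < r. Proof. exact: ltnW. Qed.

(** Saturate the cluster formed by the single edge of [c] and contract it. Few colors leave the
    result, so the loss fits in [A - A'], and at least the singleton class [c] disappears. *)
Lemma contract_single A' c : A' + r * (4 * r ^ 2 + 6 * r) <= A ->
  (forall (E' : C -> {set {set V}}) (W' : {set V}) (K' : {set C}),
    classes r E' W' K' -> W' != set0 -> #|W'| + k <= #|K'| ->
    #|singles E' K'| < #|singles E K| -> short r E' K' A') ->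
  c \notin singles E K.
Proof.
move=> AA IHs; apply/negP => cs; have := cs; rewrite inE => /andP [cK /cards1P [e Ee]].
have eE : e \in E c by rewrite Ee set11.
have /set0Pn [a ae] : e != set0.
  by case: EWK => /(_ _ _ cK eE) + _ _; rewrite -card_gt0 => ->.
have [b [eab ba aW bW]] := edge_pair EWK cK eE ae.
have cl1 : cluster E W K [set a; b] [set c] 1.
  split; rewrite ?sub1set ?subUset ?sub1set ?aW ?bW //.
    by rewrite cards2 eq_sym ba cards1.
  have ab : rconn E [set c] 1 a b by apply: rconn1; rewrite -eab.
  move=> u v /set2P [] -> /set2P [] -> //; try exact: rconn0.
  exact: rconn_sym.
have [B [U [t [clB sat B1 U1 tb]]]] := cluster_saturate r0 EWK cl1.
(* This weight exactly pays for the diameter 1 of the edge, so saturation leaves a debt of [2 * r]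
   only. *)
have wc : weight r E [set c] = r by rewrite /weight big_set1 Ee cards1 subSS subn0.
have tb2 : r * t <= weight r E U + 2 * r.
  by move: tb; rewrite wc muln1; clear; lia.
have nocyc := no_rcyc_cluster A4 long clB tb2.
have nocyc1 : ~ rcyc E K t.+1 by move=> h; apply: nocyc; apply: rcyc_sub h.
have cB : 1 < #|B|.
  by apply: leq_trans (subset_leq_card B1); rewrite cards2 eq_sym ba.
have few := few_leaving r2 A4 EWK excess long IH (leqnn _) clB (ltnW cB) tb2.
have [|l lc lb] := short_contract (k := k) (A' := A') EWK excess nocyc1 clB sat cB.
  move=> E' W' K' cl' W'0 ex' sing _; apply: IHs cl' W'0 ex' _.
  apply: leq_ltn_trans (subset_leq_card sing) _; apply: proper_card.
  apply/properP; split; first exact: subsetDl.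
  by exists c => //; rewrite inE (subsetP U1) ?set11.
apply: long; exists l => //.
have := leq_mul (leqnn r.-1) (ltnW few).
rewrite -addnA -mulnDl; set X := 4 * r ^ 2 + 6 * r.
have rX : r * X = r.-1 * X + X by rewrite -mulSnr prednK.
have X2 : 2 * r <= X by apply: leq_trans (leq_addl _ _); rewrite leq_mul2r orbT.
by move: lb tb2 AA; rewrite -/X rX; move: X2; clear; lia.
Qed.

(** If [z] covers no class, deleting it keeps every color and raises the excess. Only the few colors
    touching [z] gain weight, at most [r] each, or become singletons. *)
Lemma delete_vertex A' z : A' + r * (4 * r ^ 2 + 4 * r) <= A -> z \in W ->
  #|singles E K| = 0 ->
  (forall (E' : C -> {set {set V}}) (W' : {set V}) (K' : {set C}),
    classes r E' W' K' -> W' != set0 -> #|W'| + k.+1 <= #|K'| ->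
    #|singles E' K'| <= 4 * r ^ 2 + 4 * r -> short r E' K' A') ->
  exists2 c, c \in K & covers E z c.
Proof.
move=> AA zW no1 IHk; apply: contrapT => ncov.
have {}ncov c : c \in K -> exists2 e, e \in E c & z \notin e.
  move=> cK; apply: contrapT => no; apply: ncov; exists c => //.
  by apply/forall_inP => e eE; apply/negPn/negP => ze; apply: no; exists e.
pose E' c := [set e in E c | z \notin e].
have E'E c : E' c \subset E c by apply/subsetP => e; rewrite inE => /andP [].
have few : #|leaving E K [set z] set0| < 4 * r ^ 2 + 4 * r + 0.
  have := few_leaving r2 A4 EWK excess long IH (leq0n _) (cluster1 E K zW).
  by rewrite cards1 muln0; apply.
rewrite addn0 in few.
have same c : c \in K -> c \notin leaving E K [set z] set0 -> E' c = E c.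
  move=> cK; rewrite !inE cK /= => no; apply/setP => e; rewrite inE.
  case: (boolP (e \in E c)) => //= eE; apply: contra no => ze.
  apply/existsP; exists e; rewrite eE /=; apply/set0Pn; exists z.
  by rewrite !inE ze eqxx.
have K0 : 0 < #|K|.
  by apply: leq_trans excess; rewrite addn_gt0 card_gt0 W0.
have cl' : classes r E' (W :\ z) K.
  case: EWK => E2 EW Er; split=> [c e|c e|c] cK.
  - by move/(subsetP (E'E c)); exact: E2.
  - by rewrite inE subsetD1 => /andP [/(EW _ _ cK) ->].
  - have [e eE ze] := ncov _ cK; apply/andP; split.
      by rewrite card_gt0; apply/set0Pn; exists e; rewrite inE eE.
    by have /andP [_] := Er _ cK; apply: leq_trans; apply: subset_leq_card.
have [l lc lb] : short r E' K A'.
  apply: (IHk _ (W :\ z)) => //.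
  - have [c cK] := card_gt0P K0; have [e eE ze] := ncov _ cK.
    have /set0Pn [y ye] : e != set0.
      by case: EWK => /(_ _ _ cK eE) + _ _; rewrite -card_gt0 => ->.
    apply/set0Pn; exists y; case: EWK => _ /(_ _ _ cK eE) /subsetP /(_ _ ye) yW _.
    by rewrite !inE yW andbT; apply: contraNneq ze => <-.
  - by move: excess; rewrite (cardsD1 z W) zW; clear; lia.
  - apply: leq_trans (ltnW few); apply: subset_leq_card; apply/subsetP => c.
    rewrite inE => /andP [cK c1]; apply/negPn/negP => cL.
    rewrite (same _ cK cL) in c1; move/eqP: no1; rewrite cards_eq0 => /eqP/setP/(_ c).
    by rewrite !inE cK c1.
apply: long; exists l; first by apply: rcyc_mono lc => c _.
apply: leq_trans lb _; apply: leq_trans (leq_add (leqnn _) AA).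
set L := leaving E K [set z] set0 in few same; rewrite [A' + _]addnC addnA leq_add2r.
apply: (@leq_trans (weight r E K + r * #|L|)); last first.
  by rewrite leq_add2l leq_mul2l ltnW ?orbT.
have LK : L \subset K by apply/subsetP => c; rewrite !inE => /andP [/andP []].
rewrite /weight (big_setID L) /= [X in _ <= X + _](big_setID L) /= (setIidPr LK).
rewrite addnAC leq_add //.
  rewrite -[r * _]mulnC -sum_nat_const -big_split /=; apply: leq_sum => c cL.
  by case: EWK => _ _ /(_ _ (subsetP LK _ cL)) /andP [_]; move: #|_| #|_|; clear; lia.
by apply: leq_sum => c /setDP [cK cL]; rewrite same.
Qed.

End Induction.

(* Number of times a ball doubles; any [m] with [2 * r * m < 2 ^ m] would do. *)
Definition steps r := 2 * trunc_log 2 r + 6.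

Definition max_excess r := (r * steps r).*2.

(* [r] times the additive error for [k] more colors than vertices and at most
   [j] classes of size 1. *)
Definition cost r k j :=
  (max_excess r - k) * ((r + r * (4 * r ^ 2 + 6 * r)) * (4 * r ^ 2 + 4 * r)) +
  r * (4 * r ^ 2 + 6 * r) * j + (r * (2 * (r * r)) + 2 * r).

Lemma max_excess_lt r : 0 < r -> max_excess r < 2 ^ steps r.
Proof.
move=> r0; rewrite /max_excess /steps; set t := trunc_log 2 r.
have rt : r < 2 ^ t.+1 by apply: trunc_log_ltn.
have tt : 2 * t + 6 <= 2 ^ t.+4.
  rewrite (_ : 2 * t + 6 = 2 * t.+3); last by clear; lia.
  by rewrite expnS leq_mul2l ltnW // ltn_expl.
rewrite (_ : 2 * t + 6 = t.+1 + t.+4 + 1) in tt *; last by clear; lia.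
rewrite -muln2 expnD expn1 ltn_pmul2r //.
apply: leq_ltn_trans (leq_mul (leqnn r) tt) _.
by rewrite expnD ltn_pmul2r // expn_gt0.
Qed.

Lemma cost_ge4 r k j : 1 < r -> 4 * r <= cost r k j.
Proof.
move=> r2; apply: leq_trans (leq_addl _ _).
rewrite (_ : 4 * r = r * 2 + 2 * r); last by clear; lia.
by rewrite leq_add2r leq_mul2l leq_pmulr ?orbT // muln_gt0 ltnW.
Qed.

Lemma cost_le r : 1 < r -> cost r 0 0 <= 776 * r ^ 6 * trunc_log 2 r.
Proof.
move=> r2; have t1 : 0 < trunc_log 2 r by rewrite trunc_log_gt0 r2.
rewrite /cost /max_excess /steps; set t := trunc_log 2 r in t1 *.
(* After the shifts [r = s + 2] and [t = q + 1], the difference of the two sides has non-negative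
   coefficients. *)
have [s ->] : exists s, r = s + 2 by exists (r - 2); rewrite subnK.
have [q ->] : exists q, t = q + 1 by exists (t - 1); rewrite subnK.
rewrite subn0 muln0 -!muln2; move: s q => {r r2 t t1} s q.
nia.
Qed.

(** The induction is lexicographic: on the excess still missing, then on the allowed number of
    singleton classes, then on the number of vertices. Deletion uses the first, [contract_single]
    the second, and the contractions behind [few_leaving] the third. *)
Lemma short_cost (V C : finType) r k j (E : C -> {set {set V}}) (W : {set V})
    (K : {set C}) : 1 < r -> classes r E W K -> W != set0 ->
  #|W| + k <= #|K| -> #|singles E K| <= j -> short r E K (cost r k j).
Proof.
move=> r2; have r0 : 0 < r by exact: ltnW.
have [d] := ubnP (max_excess r - k); elim: d k j E W K => // d IHd k j E W K.
rewrite ltnS => kd; have [J] := ubnP j; elim: J j E W K => // J IHj j E W K.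
rewrite ltnS => jJ; have [w] := ubnP #|W|.
elim: w E W K => // w IHw E W K; rewrite ltnS => Ww EWK W0 ex sj.
have [kx | kx] := leqP (max_excess r) k.
  apply: short_leq (leq0n _) (short_of_excess EWK W0 r0 _ (max_excess_lt r0) _).
    by rewrite addn_gt0 orbT.
  by apply: leq_trans ex; rewrite leq_add2l.
apply: contrapT => long; have A4 := cost_ge4 k j r2.
have IH (E' : C -> {set {set V}}) (W' : {set V}) (K' : {set C}) :
    classes r E' W' K' -> W' != set0 -> #|W'| + k <= #|K'| ->
    #|singles E' K'| <= #|singles E K| -> #|W'| < #|W| -> short r E' K' (cost r k j).
  move=> cl' W'0 ex' s' lt; apply: IHw cl' W'0 ex' (leq_trans s' sj).
  exact: leq_trans lt Ww.
have [no1 | s1] := posnP #|singles E K|.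
  have E2 c : c \in K -> 1 < #|E c|.
    move=> cK; case: EWK => _ _ /(_ _ cK) /andP [E0 _].
    rewrite ltn_neqAle E0 andbT eq_sym; apply/negP => c1.
    by move/eqP: no1; rewrite cards_eq0 => /eqP/setP/(_ c); rewrite !inE cK c1.
  apply: (long); apply: (short_leq (leq_addl _ _)).
  apply: (short_of_covers r2 EWK W0 E2) => z zW.
  (* One unit of excess is bought for [r * D], the weight gained by deletion, plus the price of
     eliminating up to [D] new singleton classes. *)
  set D := 4 * r ^ 2 + 4 * r.
  apply: (delete_vertex (A' := cost r k.+1 D) r2 A4 EWK W0 ex long IH _ zW no1).
    rewrite -/D /cost (_ : max_excess r - k = (max_excess r - k.+1).+1); last first.
      by move: kx; clear; lia.
    rewrite -/D mulSn mulnDl; clear; lia.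
  move=> E' W' K' cl' W'0 ex' s'; apply: IHd cl' W'0 ex' s'.
  by move: kx kd; clear; lia.
have /set0Pn [c cs] : singles E K != set0 by rewrite -card_gt0.
have j0 : 0 < j by apply: leq_trans sj.
apply/negP: cs; apply: (contract_single (A' := cost r k j.-1) r2 A4 EWK ex long IH).
  rewrite /cost -[in X in _ <= X](prednK j0) mulnS; clear; lia.
move=> E' W' K' cl' W'0 ex' s'; apply: IHj cl' W'0 ex' _.
  by move: j0 jJ; clear; lia.
by move: (leq_trans s' sj) j0; clear; lia.
Qed.

(** * Edge-colored graphs *)

Section CyclicIndexing.
Variables V C : finType.

Lemma cwalk_nth (E : C -> {set {set V}}) c d u s i : cwalk E u s -> i < size s ->
  [set nth d (u :: unzip2 s) i; nth d (unzip2 s) i] \in E (nth c (unzip1 s) i).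
Proof.
elim: s u i => [|[a x] s IHs] u [|i] //= /andP [e w] // si.
exact: IHs.
Qed.

(* [b] lists the tails of the steps of a closed walk; the heads are the tails
   shifted cyclically. *)
Lemma closed_tails (d u : V) p : 0 < size p -> last u p = u -> uniq p ->
  exists b : seq V, [/\ size b = size p, uniq b
    & forall i, i < size p -> nth d b i = nth d (u :: p) i /\
        nth d b (i.+1 %% size p) = nth d p i].
Proof.
move=> p0 pu pU; exists (belast u p).
have lI : u :: p = rcons (belast u p) u by rewrite lastI pu.
have bi i : i < size p -> nth d (belast u p) i = nth d (u :: p) i.
  by move=> ip; rewrite lI nth_rcons size_belast ip.
split; rewrite ?size_belast //.
  rewrite (perm_uniq (s2 := p)) // -(perm_cons u) lI.
  by rewrite perm_sym perm_rcons.
move=> i ip; split; first exact: bi.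
have [ip1 | pi1] := ltnP i.+1 (size p); first by rewrite modn_small // bi.
have -> : i.+1 = size p by apply/eqP; rewrite eqn_leq ip.
rewrite modnn bi //= -[LHS]pu (last_nth d) /=.
have -> : size p = i.+1 by apply/eqP; rewrite eqn_leq ip andbT.
by [].
Qed.

End CyclicIndexing.

Section GraphClasses.
Variable G : ecgraph.

Definition end_pairs (c : palette G) : {set {set vertex G}} :=
  [set ends e | e in color_class c].

(** Vertices are indexed by the tails of the steps, so that [ordS] gives the heads; the edges are
    pairwise distinct because their colors are. *)
Lemma rainbow_cycle_of_rcyc l : rcyc end_pairs (colors G) l ->
  exists2 k, has_rainbow_cycle G k & k <= l.
Proof.
case/rcyc_simple => u [s [/and4P [w /eqP su cU _] s0 sl sU]].
exists (size s) => //.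
have [|||b [bs bU bP]] := @closed_tails _ u u (unzip2 s); rewrite ?size_map //.
case: s s0 => [//|[c0 x0] s'] s0 in w su cU sl sU bs bP *; set s := _ :: s' in w su cU sl sU bs bP *.
have edge_at (i : 'I_(size s)) : exists e : edge G,
    color e = nth c0 (unzip1 s) i /\
    ends e = [set nth u (u :: unzip2 s) i; nth u (unzip2 s) i].
  have /imsetP [e] := cwalk_nth c0 u w (ltn_ord i).
  by rewrite inE => /eqP ec ee; exists e.
have [f fP] := fin_all_exists edge_at.
have col_inj (i j : 'I_(size s)) : color (f i) = color (f j) -> i = j.
  have [-> _] := fP i; have [-> _] := fP j; move/eqP.
  by rewrite nth_uniq ?size_map // => /eqP/val_inj.
exists (fun i => nth u b i), f; split; first split => //.
- move=> i j /eqP; rewrite nth_uniq ?bs ?size_map // => /eqP/val_inj //.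
- by move=> i j ij; apply: col_inj; rewrite ij.
- move=> i; have [_ ->] := fP i; have [] := bP i; first by rewrite size_map.
  by rewrite size_map /= => -> ->.
- by move=> _ _ /imsetP [i _ ->] /imsetP [j _ ->] /col_inj ->.
Qed.

Lemma short_rainbow_cycle r : 1 < r -> 0 < #|vertex G| -> simple_ecgraph G ->
  #|colors G| = #|vertex G| ->
  (forall c, c \in colors G -> 1 < #|color_class c| <= r) ->
  exists2 k, has_rainbow_cycle G k &
    r * k <= #|vertex G| + deficiency G r + cost r 0 0.
Proof.
move=> r2 n0 simp cn sz.
(* A loop is a rainbow cycle of length 1; without loops all edges are genuine pairs. *)
have [[e0 /cards1P [v ev]] | noloop] := pselect (exists e : edge G, #|ends e| == 1).
  exists 1.
    exists (fun=> v), (fun=> e0); split; first split => //.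
    - by move=> i j _; rewrite !ord1.
    - by move=> i j _; rewrite !ord1.
    - by move=> i; rewrite ev; apply/setP => x; rewrite !inE orbb.
    - by move=> _ _ /imsetP [i _ ->] /imsetP [j _ ->].
  rewrite muln1; apply: leq_trans (leq_addl _ _).
  apply: leq_trans (cost_ge4 0 0 r2); exact: leq_pmull.
have e2 (e : edge G) : #|ends e| = 2.
  apply/eqP; rewrite eqn_leq; have /andP [e0 ->] := card_ends e.
  rewrite ltn_neqAle e0 andbT eq_sym; apply/negP => e1; apply: noloop.
  by exists e.
(* Simplicity is what lets a class be replaced by its set of end pairs without losing edges. *)
have cE c : #|end_pairs c| = #|color_class c|.
  rewrite card_in_imset // => e f ec fc ef; apply/eqP/negPn/negP => nef.
  by apply: (simp c e f) => //; split=> //; apply/eqP.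
have cl : classes r end_pairs [set: vertex G] (colors G).
  split=> [c e _ /imsetP [f _ ->] | c e _ _ | c cc].
  - exact: e2.
  - exact: subsetT.
  - by rewrite cE; have /andP [/ltnW -> ->] := sz _ cc.
have W0 : [set: vertex G] != set0 by rewrite -card_gt0 cardsT.
have [||l lc lb] := short_cost (k := 0) (j := 0) r2 cl W0.
- by rewrite addn0 cardsT cn.
- rewrite leqn0 cards_eq0; apply/eqP/setP => c; rewrite !inE.
  apply/negP => /andP [cc /eqP c1]; have := sz _ cc.
  by rewrite -cE c1.
have [k ck kl] := rainbow_cycle_of_rcyc lc; exists k => //.
apply: leq_trans (leq_mul (leqnn r) kl) _; apply: leq_trans lb _.
rewrite leq_add2r -cn -sum1_card /deficiency /weight.
rewrite [X in _ + X](eq_bigl (fun c => c \in colors G)); last first.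
  by move=> c; case cc: (c \in colors G); have := sz c; rewrite cc //= => /(_ isT) /andP [].
rewrite -big_split /=; apply: leq_sum => c cc; rewrite cE.
by have /andP [_] := sz _ cc; move: #|_|; clear; lia.
Qed.

End GraphClasses.

(* The real-valued bound and the growth of the constant *)
From HB Require Import structures.
From mathcomp Require Import all_boot all_order all_algebra.
From mathcomp Require Import all_classical all_reals all_analysis.

Import Order.TTheory GRing.Theory Num.Theory.
Import numFieldNormedType.Exports.

Local Open Scope classical_set_scope.
Local Open Scope ring_scope.

Lemma trunc_log_le_log2 (R : realType) r : (0 < r)%N ->
  (trunc_log 2 r)%:R <= log2 (r%:R : R).
Proof.
move=> r0; have l2 : 0 < ln 2 :> R by rewrite ln_gt0 // ltr1n.
rewrite /log2 ler_pdivlMr // mulr_natl -lnXn ?ltr0n // ler_ln ?posrE ?exprn_gt0 ?ltr0n //.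
by rewrite -natrX ler_nat trunc_logP.
Qed.

Theorem theorem1p7 (R : realType) :
  exists alpha : nat -> R,
    alpha =O_\oo (fun r : nat => r%:R ^+ 5 * log2 (r%:R : R) ^+ 2) /\
    forall r : nat, (2 <= r)%N ->
    forall (G : ecgraph) (n : nat),
      (0 < n)%N ->
      #|vertex G| = n ->
      simple_ecgraph G ->
      #|colors G| = n ->
      (forall c, c \in colors G -> (2 <= #|color_class c| <= r)%N) ->
      exists2 k : nat, has_rainbow_cycle G k &
        k%:R <= (n + deficiency G r)%:R / r%:R + alpha r.
Proof.
(* Excess and singleton count both start at 0. By [cost_le] this constant is even of order
   [r ^ 5 * log r]; the second logarithm comes free because [log2 r] is at least 1. *)
exists (fun r => (cost r 0 0)%:R / r%:R); split.
  apply/eqO_exP; exists 776; first by rewrite ltr0n.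
  exists 2%N => // r /= r2; have r0 : (0 < r)%N by apply: ltnW.
  have t1 : (1 : R) <= (trunc_log 2 r)%:R by rewrite ler1n trunc_log_gt0 r2.
  have tl := trunc_log_le_log2 R r0; have l1 := le_trans t1 tl.
  have l0 : 0 <= log2 (r%:R : R) by apply: le_trans l1.
  have g0 : 0 <= r%:R ^+ 5 * log2 (r%:R : R) ^+ 2.
    by apply: mulr_ge0; apply: exprn_ge0.
  rewrite ger0_norm ?divr_ge0 // (ger0_norm g0).
  rewrite ler_pdivrMr ?ltr0n //.
  apply: (@le_trans _ _ (776 * r ^ 6 * trunc_log 2 r)%N%:R).
    by rewrite ler_nat cost_le.
  rewrite natrM natrM natrX.
  rewrite [X in _ <= X](_ : _ = 776 * r%:R ^+ 6 * log2 (r%:R : R) ^+ 2); last by ring.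
  apply: ler_wpM2l.
    by apply: mulr_ge0; [exact: ler0n | apply: exprn_ge0; exact: ler0n].
  by rewrite expr2; apply: le_trans tl _; exact: ler_peMl.
move=> r r2 G n n0 Gn simp cn sz; have r0 : (0 < r)%N by apply: ltnW.
have [||k ck kb] := short_rainbow_cycle r2 _ simp _ sz; rewrite ?Gn ?cn //.
exists k => //; rewrite -mulrDl ler_pdivlMr ?ltr0n // -natrM -natrD ler_nat mulnC.
by rewrite -Gn.
Qed.
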